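(* Let $\beta\in(0,1)$, $d\in\mathbb{N}$ with $d>2/\beta$. Let $\eta_t$ be the clusters of a $(2,\beta)$-superprocess $\xi$ in $\mathbb{R}^d$, and for $K>0$ let $\eta^K_t$ be the clusters of the truncated $K$-process $\xi^K$ of $\xi$. Then there are constants $c,C\in(0,\infty)$ depending only on $\beta$ and $d$ such that for every $\sigma$-finite measure $\mu$ on $\mathbb{R}^d$ and all $0<\varepsilon\le\sqrt t$: (i) with $t'=\beta t/(1+\beta)$, $$c\,\mu p_{t'}\ \le\ \varepsilon^{2/\beta-d}(\beta t)^{-1/\beta}P_\mu\{\eta_tB_0^\varepsilon>0\}\ \le\ C\,\mu p_{2t};$$ (ii) $\displaystyle \varepsilon^{2/\beta-d}\,a_t^{-1}\,P_\mu\{\eta_t^KB_0^\varepsilon>0\}\ \le\ C\,\mu p_{2t}$, where $a_t=a_K(t)$.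
   Context: Notation: $\mu f=\int f\,d\mu$, $B_x^r$ is the open ball of radius $r$ around $x$, and $p_t(x)=(2\pi t)^{-d/2}e^{-|x|^2/(2t)}$. A $(2,\beta)$-superprocess $\xi=(\xi_t)_{t\ge0}$ in $\mathbb{R}^d$, $\beta\in(0,1)$, is a vaguely rcll measure-valued strong Markov process with $E_\mu e^{-\xi_t f}=e^{-\mu v_t}$ for suitable (e.g. bounded measurable) $f\ge0$, where $v$ is the unique (mild) solution of $\dot v=\frac12\Delta v-v^{1+\beta}$, $v_0=f$. Truncated $K$-process: let $c_\beta=\beta(1+\beta)/\Gamma(1-\beta)$, so that $\lambda^{1+\beta}=c_\beta\int_0^\infty(e^{-\lambda r}-1+\lambda r)r^{-2-\beta}dr$ (the jumps $r\delta_x$ of $\xi$ have compensator $c_\beta\,dt\,r^{-2-\beta}dr\,\xi_t(dx)$). For $K>0$ let $M_K(\lambda)=\lambda c_\beta\int_K^\infty r^{-1-\beta}dr+c_\beta\int_0^K(e^{-\lambda r}-1+\lambda r)r^{-2-\beta}dr$. The truncated $K$-process $\xi^K$ is the rcll measure-valued Markov process with $E_\mu e^{-\xi^K_tf}=e^{-\mu v_t}$, where $\dot v=\frac12\Delta v-M_K(v)$, $v_0=f$. Intuitively, it is $\xi$ minus all mass produced by jumps of size greater than $K$, along with the future evolution of that mass. Let $a_K(t)=\lim_{\theta\to\infty}1/v(t,\theta)$, where $v(\cdot,\theta)$ solves $\dot v=-M_K(v)$, $v(0,\theta)=\theta$. Clusters: $P_x\{\eta_t\in\cdot\}$ and $P_x\{\eta_t^K\in\cdot\}$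 are the probability laws on nonzero measures with $E_{\delta_x}e^{-\xi_tf}=\exp\{-(\beta t)^{-1/\beta}E_x(1-e^{-\eta_tf})\}$ and $E_{\delta_x}e^{-\xi^K_tf}=\exp\{-a_K(t)^{-1}E_x(1-e^{-\eta^K_tf})\}$ for all $f\ge0$. For any $\sigma$-finite $\mu$, $P_\mu\{\eta_t\in\cdot\}=\int\mu(dx)P_x\{\eta_t\in\cdot\}$, and similarly for $\eta_t^K$ (these need not be probability measures). *)

(* Defs.v *)
From HB Require Import structures.
From mathcomp Require Import all_boot all_order all_algebra.
From mathcomp Require Import all_classical all_reals all_analysis.
From mathcomp Require Import measurable_realfun giry.

Set Implicit Arguments.
Unset Strict Implicit.
Unset Printing Implicit Defensive.

Import Order.TTheory GRing.Theory Num.Def Num.Theory.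
Import numFieldNormedType.Exports.

Local Open Scope classical_set_scope.
Local Open Scope ring_scope.

(* Points of R^d are row vectors 'rV[R]_d, with the Borel sigma-algebra. *)
Section borel_matrix.
Context (R : realType) (m n : nat).

Definition mx_borel : set (set 'M[R]_(m, n)) := <<s open >>.

Let mx_borel0 : mx_borel set0.
Proof. exact: sigma_algebra0. Qed.

Let mx_borelC A : mx_borel A -> mx_borel (~` A).
Proof. exact: sigma_algebraC. Qed.

Let mx_borelU (F : (set 'M[R]_(m, n))^nat) :
  (forall i, mx_borel (F i)) -> mx_borel (\bigcup_i F i).
Proof. exact: sigma_algebra_bigcup. Qed.

Definition mx_borel_display : measure_display.
Proof. by constructor. Qed.

HB.instance Definition _ := @isMeasurable.Build mx_borel_display
  'M[R]_(m, n) mx_borel mx_borel0 mx_borelC mx_borelU.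

End borel_matrix.

Section borel_matrix_lemmas.
Context (R : realType).

Lemma measurable_coord n (i : 'I_n) :
  measurable_fun setT (fun x : 'rV[R]_n => x ord0 i).
Proof.
apply: (measurability (@RGenOpens.G R)); first exact: RGenOpens.measurableE.
move=> _ [_ [a [b ->]] <-]; rewrite setTI.
apply: sub_sigma_algebra.
have /continuousP := @coord_continuous R 1 n ord0 i; apply.
exact: interval_open.
Qed.

Lemma measurable_fun_rV d (T : measurableType d) n (f : T -> 'rV[R]_n) :
  (forall i, measurable_fun setT (fun x => f x ord0 i)) ->
  measurable_fun setT f.
Proof.
move=> mf; apply: (@measurability _ _ T _ setT f (@open 'rV[R]_n)) => //.
move=> _ [U oU <-]; rewrite setTI.
pose box (qr : 'rV[rat]_n * rat) :=
  [set y : 'rV[R]_n | forall i, `|ratr (qr.1 ord0 i) - y ord0 i| < ratr qr.2].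
pose I qr := box qr `<=` U.
have -> : U = \bigcup_qr (if `[< I qr >] then box qr else set0).
  apply/seteqP; split=> [x Ux|x [qr _]]; last first.
    by case: asboolP => // qrU; exact: qrU.
  have /nbhs_ballP[e /= e0 xeU] : nbhs x U by exact: open_nbhs_nbhs.
  have [r] : exists r : rat, ratr r \in `]0, (e / 2)[.
    by apply: rat_in_itvoo; rewrite divr_gt0.
  rewrite in_itv /= => /andP[r0 re].
  have /choice[q Pq] (i : 'I_n) :
      exists q : rat, `|ratr q - x ord0 i| < ratr r.
    have [q] : exists q : rat,
        ratr q \in `]x ord0 i - ratr r, x ord0 i + ratr r[.
      by apply: rat_in_itvoo; rewrite ltrD2l gtrN.
    by rewrite in_itv /= => qx; exists q; rewrite ltr_distl.
  exists (\row_i q i, r) => //; rewrite ifT.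
    by move=> i /=; rewrite mxE; exact: Pq.
  apply/asboolP => y /= xy; apply: xeU; split => // i j.
  rewrite !ord1 /ball /=; have := xy j; rewrite mxE => qy.
  rewrite (splitr e) (le_lt_trans (ler_distD (ratr (q j)) _ _))// ltrD//.
    by rewrite distrC; exact: lt_trans (Pq j) re.
  exact: lt_trans qy re.
rewrite preimage_bigcup; apply: countable_bigcupT_measurable => [|qr].
  exact: countableP.
case: asboolP => _; last by rewrite preimage_set0.
have -> : f @^-1` box qr = \bigcap_(i in [set: 'I_n])
    ((fun x => f x ord0 i) @^-1` ball (ratr (qr.1 ord0 i) : R) (ratr qr.2)).
  apply/seteqP; split=> [x bx i _|x bx i].
    by have := bx i; rewrite /= /ball /=.
  by have := bx i Logic.I; rewrite /= /ball /=.
apply: fin_bigcap_measurable => // i _.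
rewrite -[X in measurable X]setTI; apply: mf => //.
apply: open_measurable; exact: ball_open.
Qed.

End borel_matrix_lemmas.

Section pushforward_measure.
Context d d' (T1 : measurableType d) (T2 : measurableType d') (R : realType).

Definition pushforward_measure (m : {measure set T1 -> \bar R}) (f : T1 -> T2)
    (mf : measurable_fun setT f) : {measure set T2 -> \bar R} :=
  measure_function_pushforward__canonical__measure_function_Measure m mf.

End pushforward_measure.

Section lebesgue_measure_rV.
Context (R : realType).
Local Open Scope ereal_scope.

Definition row_cons n (p : 'rV[R]_n * measurableTypeR R) : 'rV[R]_n.+1 :=
  \row_(i < n.+1) oapp (fun j => p.1 ord0 j) p.2 (unlift ord0 i).

Lemma row_cons0 n (p : 'rV[R]_n * measurableTypeR R) : row_cons p ord0 ord0 = p.2.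
Proof. by rewrite mxE unlift_none. Qed.

Lemma row_consS n (p : 'rV[R]_n * measurableTypeR R) (j : 'I_n) :
  row_cons p ord0 (lift ord0 j) = p.1 ord0 j.
Proof. by rewrite mxE liftK. Qed.

Lemma measurable_row_cons n : measurable_fun setT (@row_cons n).
Proof.
apply: measurable_fun_rV => i; case: (unliftP ord0 i) => [j|] ->.
  under eq_fun do rewrite row_consS.
  exact: measurableT_comp (measurable_coord j) measurable_fst.
under eq_fun do rewrite row_cons0.
exact: measurable_snd.
Qed.

(* Lebesgue measure on R^n, as an n-fold product of Lebesgue measures on R *)
Fixpoint lebesgue_rV n : {measure set 'rV[R]_n -> \bar R} :=
  if n is n'.+1 then
    pushforward_measure
      (lebesgue_rV n' \x lebesgue_measure)
      (@measurable_row_cons n')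
  else \d_(0%R : 'rV[R]_0).

Lemma lebesgue_rV_box n (A : 'I_n -> set R) : (forall i, measurable (A i)) ->
  lebesgue_rV n [set x | forall i, A i (x ord0 i)] =
  \prod_(i < n) lebesgue_measure (A i).
Proof.
elim: n A => [|n IH] A mA.
  by rewrite big_ord0 /= diracE mem_set// => -[].
rewrite big_ord_recl /= /pushforward.
rewrite [X in product_measure1 _ _ X](_ : _ =
    [set x : 'rV[R]_n | forall i : 'I_n, A (lift ord0 i) (x ord0 i)]
    `*` A ord0); last first.
  apply/seteqP; split=> [[x y] /= Axy|[x y] /= [Ax Ay] i].
    split=> [i|]; first by have := Axy (lift ord0 i); rewrite row_consS.
    by have := Axy ord0; rewrite row_cons0.
  case: (unliftP ord0 i) => [j|] ->; last by rewrite row_cons0.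
  by rewrite row_consS; exact: Ax.
rewrite product_measure1E//; first by rewrite muleC; congr (_ * _); exact: IH.
  2: exact: (mA ord0).
rewrite [X in measurable X](_ : _ = \bigcap_(i in [set: 'I_n])
    ((fun x : 'rV[R]_n => x ord0 i) @^-1` A (lift ord0 i))); last first.
  by apply/seteqP; split=> [x Ax i _|x Ax i]; [exact: Ax|exact: Ax i Logic.I].
apply: fin_bigcap_measurable => // i _.
rewrite -[X in measurable X]setTI; exact: measurable_coord.
Qed.

End lebesgue_measure_rV.

Section euclidean.
Context (R : realType) (d : nat).
Implicit Types x : 'rV[R]_d.

(* The library's norm on 'rV[R]_d is the sup norm. *)
Definition enorm x : R := Num.sqrt (\sum_(i < d) x ord0 i ^+ 2).

Definition eball x (r : R) : set 'rV[R]_d := [set y | enorm (y - x) < r].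

Definition heat_kernel (t : R) x : R :=
  (2 * pi * t) `^ (- (d%:R / 2)) * expR (- (enorm x ^+ 2 / (2 * t))).

Definition heat (t : R) (f : 'rV[R]_d -> R) x : \bar R :=
  (\int[lebesgue_rV R d]_y (heat_kernel t (y - x) * f y)%:E)%E.

End euclidean.

Section locally_finite_measures.
Context (R : realType) (d : nat).
Local Open Scope ereal_scope.

Record lfmeasure := LFMeasure {
  lfm_val :> {measure set 'rV[R]_d -> \bar R} ;
  lfmP : forall B : set 'rV[R]_d, measurable B -> bounded_set B -> lfm_val B < +oo }.

Lemma mzero_locally_finite (B : set 'rV[R]_d) :
  measurable B -> bounded_set B -> (mzero : {measure set _ -> \bar R}) B < +oo.
Proof. by rewrite /= ltry. Qed.

Lemma dirac_locally_finite (x : 'rV[R]_d) (B : set 'rV[R]_d) :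
  measurable B -> bounded_set B -> (\d_x : {measure set _ -> \bar R}) B < +oo.
Proof. by rewrite /= diracE ltry. Qed.

Definition lf_dirac x := LFMeasure (@dirac_locally_finite x).

HB.instance Definition _ := gen_eqMixin lfmeasure.
HB.instance Definition _ := gen_choiceMixin lfmeasure.
HB.instance Definition _ :=
  isPointed.Build lfmeasure (LFMeasure mzero_locally_finite).

(* sigma-algebra generated by the evaluations m |-> m B, B Borel *)
Definition lfm_measurable : set (set lfmeasure) :=
  <<s \bigcup_(B in measurable)
        preimage_set_system setT (fun m : lfmeasure => m B) measurable >>.

Let lfm_measurable0 : lfm_measurable set0.
Proof. exact: sigma_algebra0. Qed.

Let lfm_measurableC A : lfm_measurable A -> lfm_measurable (~` A).
Proof. exact: sigma_algebraC. Qed.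

Let lfm_measurableU (F : (set lfmeasure)^nat) :
  (forall i, lfm_measurable (F i)) -> lfm_measurable (\bigcup_i F i).
Proof. exact: sigma_algebra_bigcup. Qed.

Definition lfm_display : measure_display.
Proof. by constructor. Qed.

HB.instance Definition _ := @isMeasurable.Build lfm_display lfmeasure
  lfm_measurable lfm_measurable0 lfm_measurableC lfm_measurableU.

Definition vague_cvg (F : set_system lfmeasure) (m : lfmeasure) :=
  forall f : 'rV[R]_d -> R, continuous f ->
    compact (closure [set x | f x != 0%R]) -> (forall x, (0 <= f x)%R) ->
    (fun n : lfmeasure => \int[n]_x (f x)%:E) @ F --> \int[m]_x (f x)%:E.

End locally_finite_measures.

Section branching_mechanisms.
Context (R : realType) (beta : R).

Definition Gamma (s : R) : R :=
  \int[lebesgue_measure]_(x in `]0, +oo[) (x `^ (s - 1) * expR (- x)).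

Definition stable_mechanism (l : R) : R := l `^ (1 + beta).

Definition c_beta : R := beta * (1 + beta) / Gamma (1 - beta).

Definition truncated_mechanism (K l : R) : R :=
  l * c_beta * (\int[lebesgue_measure]_(r in `]K, +oo[) r `^ (- 1 - beta)) +
  c_beta * \int[lebesgue_measure]_(r in `]0, K[)
    ((expR (- l * r) - 1 + l * r) * r `^ (- 2 - beta)).

(* u' = - psi u on ]0, +oo[, u 0 = theta *)
Definition branching_ode (psi : R -> R) (theta : R) (u : R -> R) :=
  [/\ u 0 = theta, {within `[0, +oo[, continuous u},
      forall t : R, 0 <= t -> 0 <= u t &
      forall t : R, 0 < t -> is_derive t 1 u (- psi (u t))].

Definition branching_flow (psi : R -> R) (theta : R) : R -> R :=
  xget (cst 0) [set u | branching_ode psi theta u].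

Definition a_trunc (K t : R) : R :=
  lim ((branching_flow (truncated_mechanism K) theta t)^-1
         @[theta --> +oo]).

End branching_mechanisms.

Section measure_valued_processes.
Context (R : realType) (d : nat).
Local Notation M := (lfmeasure R d).
Local Open Scope ereal_scope.

(* mild form of dv/dt = (1/2) Laplacian v - psi(v), v_0 = f:
   v_t = P_t f - \int_0^t P_(t-s) psi(v_s) ds, in the class of nonnegative
   measurable functions that are bounded on bounded time intervals *)
Record mild_solution (psi : R -> R) (f : 'rV[R]_d -> R)
    (v : R -> 'rV[R]_d -> R) : Prop := {
  mild_measurable : measurable_fun [set tx : R * 'rV[R]_d | (0 <= tx.1)%R]
    (fun tx => v tx.1 tx.2) ;
  mild_ge0 : forall (t : R) x, (0 <= t)%R -> (0 <= v t x)%R ;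
  mild_bounded : forall T : R, exists B : R,
    forall (t : R) x, (0 <= t <= T)%R -> (v t x <= B)%R ;
  mild_init : forall x, v 0%R x = f x ;
  mild_eq : forall (t : R) x, (0 < t)%R ->
    (v t x)%:E = heat t f x -
      \int[lebesgue_measure]_(s in `]0%R, t[)
         heat (t - s) (fun y => psi (v s y)) x }.

Context (dO : measure_display) (Omega : measurableType dO).
(* law mu is the distribution P_mu of the process started at mu. *)
Variables (law : R.-pker M ~> Omega) (X : R -> Omega -> M).

(* The conditions involving law mu are imposed for finite initial measures
   only; for infinite mu, law mu is left unconstrained. *)
Record rcll_process : Prop := {
  process_measurable : forall t : R, (0 <= t)%R -> measurable_fun setT (X t) ;
  process_right : forall w (t : R), (0 <= t)%R ->
    vague_cvg (X s w @[s --> t^'+]) (X t w) ;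
  process_left : forall w (t : R), (0 < t)%R ->
    exists m, vague_cvg (X s w @[s --> t^'-]) m ;
  process_start : forall mu : M, mu setT < +oo ->
    {ae law mu, forall w, X 0%R w ≡μ mu} }.

Definition history (t : R) : set (set Omega) :=
  <<s \bigcup_(s in `[0%R, t]) preimage_set_system setT (X s) measurable >>.

Definition stopping_time (tau : Omega -> \bar R) :=
  (forall w, 0 <= tau w) /\
  (forall t : R, (0 <= t)%R -> history t [set w | tau w <= t%:E]).

Definition history_at (tau : Omega -> \bar R) (A : set Omega) :=
  measurable A /\
  forall t : R, (0 <= t)%R -> history t (A `&` [set w | tau w <= t%:E]).

Definition markov := forall mu : M, mu setT < +oo ->
  forall s t : R, (0 <= s)%R -> (0 <= t)%R ->
  forall A, history s A -> forall B, measurable B ->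
    law mu (A `&` [set w | B (X (s + t) w)]) =
    \int[law mu]_(w in A) law (X s w) [set w' | B (X t w')].

Definition strong_markov := forall mu : M, mu setT < +oo ->
  forall tau, stopping_time tau ->
  forall A, history_at tau A -> forall t : R, (0 <= t)%R ->
  forall B, measurable B ->
    law mu (A `&` [set w | tau w < +oo /\ B (X (fine (tau w) + t) w)]) =
    \int[law mu]_(w in A `&` [set w | tau w < +oo])
      law (X (fine (tau w)) w) [set w' | B (X t w')].

(* E_mu e^{-X_t f} = e^{-mu v_t} for bounded measurable f >= 0, where v is the
   mild solution started at f (unique in the class of mild_solution) *)
Definition log_laplace (psi : R -> R) :=
  forall f : 'rV[R]_d -> R, measurable_fun setT f ->
    (forall x, (0 <= f x)%R) -> (exists B, forall x, (f x <= B)%R) ->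
  exists2 v, mild_solution psi f v &
    forall mu : M, mu setT < +oo -> forall t : R, (0 <= t)%R ->
      \int[law mu]_w expeR (- \int[X t w]_x (f x)%:E) =
      expeR (- \int[mu]_x (v t x)%:E).

Definition superprocess (beta : R) :=
  [/\ rcll_process, strong_markov & log_laplace (stable_mechanism beta)].

Definition truncated_process (beta K : R) :=
  [/\ rcll_process, markov & log_laplace (truncated_mechanism beta K)].

(* eta t x is the law P_x of the cluster at time t, and g t the rate at which
   clusters occur under the law started at the unit mass at x. *)
Definition clusters (g : R -> R) (eta : R -> R.-pker 'rV[R]_d ~> M) :=
  forall (t : R) x, (0 < t)%R ->
    eta t x [set m : M | m setT = 0] = 0 /\
    forall f : 'rV[R]_d -> R, measurable_fun setT f ->
      (forall y, (0 <= f y)%R) ->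
      \int[law (lf_dirac x)]_w expeR (- \int[X t w]_y (f y)%:E) =
      expeR (- ((g t)%:E *
        \int[eta t x]_m (1 - expeR (- \int[m]_y (f y)%:E)))).

End measure_valued_processes.

(* P_mu{eta_t \in A} for a sigma-finite measure mu on R^d *)
Definition cluster_measure (R : realType) (d : nat)
    (eta : R -> R.-pker 'rV[R]_d ~> lfmeasure R d) (t : R)
    (mu : {sigma_finite_measure set 'rV[R]_d -> \bar R})
    (A : set (lfmeasure R d)) : \bar R :=
  (\int[mu]_x eta t x A)%E.

(* Main.v *)
Require Import Defs.
From HB Require Import structures.
From mathcomp Require Import all_boot all_order all_algebra.
From mathcomp Require Import all_classical all_reals all_analysis.
From mathcomp Require Import measurable_realfun ring lra.

Set Implicit Arguments.
Unset Strict Implicit.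
Unset Printing Implicit Defensive.

Import Order.TTheory GRing.Theory Num.Def Num.Theory.
Import numFieldNormedType.Exports.

Local Open Scope classical_set_scope.
Local Open Scope ring_scope.

(** A ball [B] of radius [e] is hit by a cluster when the cluster gives it positive
    mass. Let [n] be the dimension, and [l `^ (1 + b)] the stable mechanism.
    Write [v] for the mild solution started from [theta] times the indicator of the
    ball. For a process started from a unit mass at [x], the log-Laplace formula and
    the cluster representation give
      [v t x = g t * E_x (1 - exp (- theta * eta_t B))],
    and the right side increases to [g t * P_x (eta_t B > 0)] as [theta] grows. So
    everything follows from pointwise bounds on [v] which, for the upper bound, must
    not depend on [theta]. The measure [mu] enters only at the end, by integration.

    Upper bound. Follow [v] along a Brownian path that runs backwards from [x] at
    time [t]: its mean [backward_mean] decreases at the rate at which the mechanism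
    absorbs mass. This has two consequences. First, the mean satisfies the integrated
    form of [u' <= - k * u `^ (1 + b)], hence [v t x <= A * t `^ (- b^-1)] whatever
    [theta] is (lemma [mild_decay]). Second, [v] at time [t] is at most the heat
    flow of [v] at an earlier time (lemma [mild_le_heat_mild]). The two combine on
    the dyadic times [e ^+ 2 / 2 ^+ k], with radii that decrease from [2 * e] to [e]
    as [k] grows. Inside the radius of its scale the solution has at most the size
    given by the decay bound; what leaves this ball during one step has travelled
    much further than a Brownian path does in that time, and the Gaussian gain
    exceeds the growth of the decay bound (lemmas [heat_ball_far] and
    [superexp_decay]). Summing up, at time [e ^+ 2] the solution is at most
    [C * e `^ (- (2 / b))] times a sum of heat flows of the ball of radius [2 * e] at
    times comparable to [e ^+ 2], and a comparison of Gaussians concludes (theorem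
    [mild_ball_upper]).
    The argument only uses [psi l >= k0 * l `^ (1 + b)]. The truncated mechanisms
    satisfy this with one [k0] for all [K] (lemma [truncated_mechanism_ge]), so
    they are covered by the same theorem.

    Lower bound. Take [theta = c * e `^ (- (2 / b))] with [c] small. As [v] is at most
    the heat flow of its initial value, the absorbed part is at most this heat flow
    times the time integral of the supremum of the heat flow to the power [b]. The
    supremum decays like [s `^ (- (n / 2))], so the integral converges exactly when
    [n > 2 / b], and it is at most [1 / 2] for small [c]. Thus half of the heat flow
    survives (theorem [mild_ball_lower]). *)

(** * Lebesgue measure on R^n *)

Section lebesgue_rV_theory.
Context (R : realType).

Lemma measurable_box n (A : 'I_n -> set R) : (forall i, measurable (A i)) ->
  measurable [set x : 'rV[R]_n | forall i, A i (x ord0 i)].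
Proof.
move=> mA.
rewrite [X in measurable X](_ : _ = \bigcap_(i in [set: 'I_n])
    ((fun x : 'rV[R]_n => x ord0 i) @^-1` A i)); last first.
  by apply/seteqP; split=> [x Ax i _|x Ax i]; [exact: Ax|exact: Ax i Logic.I].
apply: fin_bigcap_measurable => // i _.
rewrite -[X in measurable X]setTI; exact: measurable_coord.
Qed.

Lemma sigma_finite_lebesgue_rV n : sigma_finite setT (lebesgue_rV R n).
Proof.
exists (fun k : nat => [set x : 'rV[R]_n | forall i, `]-k%:R, k%:R[%classic (x ord0 i)]).
  apply/seteqP; split=> // x _ /=.
  pose M := \sum_(i < n) `|x ord0 i|.
  exists (Num.bound M) => //= i.
  have : `|x ord0 i| < (Num.bound M)%:R.
    apply: le_lt_trans (archi_boundP _); last by exact: sumr_ge0.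
    by rewrite /M (bigD1 i)//= lerDl sumr_ge0.
  by rewrite in_itv/= ltr_norml.
move=> k; split; first exact: (@measurable_box _ (fun=> _)).
rewrite (@lebesgue_rV_box R n (fun=> _))//.
rewrite (_ : \prod_(i < n) _ = \prod_(i < n) (fine (lebesgue_measure (`]-k%:R, k%:R[%classic : set R)))%:E)%E.
  by rewrite prodEFin ltry.
apply: eq_bigr => i _; rewrite fineK// lebesgue_measure_itv/=.
by case: ifPn.
Qed.

(** A separate name for [lebesgue_rV R n], to carry the sigma-finite structure
    that Tonelli's theorem asks for. *)
Definition leb n : set 'rV[R]_n -> \bar R := lebesgue_rV R n.
Arguments leb : clear implicits.

HB.instance Definition _ n := isMeasure.Build _ _ _ (leb n)
  (measure0 (lebesgue_rV R n)) (measure_ge0 (lebesgue_rV R n))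
  (@measure_semi_sigma_additive _ _ _ (lebesgue_rV R n)).

HB.instance Definition _ n := Measure_isSigmaFinite.Build _ _ _ (leb n)
  (@sigma_finite_lebesgue_rV n).

Lemma integral_lebE n (f : 'rV[R]_n -> \bar R) :
  (\int[lebesgue_rV R n]_x f x = \int[leb n]_x f x)%E.
Proof. by []. Qed.

(** Reduces Gaussian integrals on [R^n] to one dimension. *)
Lemma integral_rV_prod n (F : 'I_n -> R -> R) :
  (forall i, measurable_fun setT (F i)) -> (forall i x, 0 <= F i x) ->
  (\int[leb n]_x (\prod_(i < n) F i (x ord0 i))%:E =
   \prod_(i < n) \int[lebesgue_measure]_x (F i x)%:E)%E.
Proof.
elim: n F => [|n IH] F mF F0.
  rewrite big_ord0 -integral_lebE integral_dirac//; last first.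
    by under eq_fun do rewrite big_ord0; exact: measurable_cst.
  by rewrite diracT mul1e big_ord0.
rewrite -integral_lebE.
rewrite ge0_integral_pushforward//=; last 3 first.
- exact: measurable_row_cons.
- apply/measurable_EFinP; apply: measurable_prod => i _.
  exact: measurableT_comp (measurable_coord i).
- by move=> x _; rewrite lee_fin prodr_ge0.
rewrite preimage_setT.
rewrite (fubini_tonelli1 (m1 := leb n) (m2 := lebesgue_measure)
  ((fun x : 'rV[R]_n.+1 => (\prod_(i < n.+1) F i (x ord0 i))%:E) \o (@row_cons R n))); last 2 first.
- apply: measurableT_comp; last exact: measurable_row_cons.
  apply/measurable_EFinP; apply: measurable_prod => i _.
  exact: measurableT_comp (measurable_coord i).
- by move=> x; rewrite lee_fin prodr_ge0.
have mp : measurable_fun setT (fun x : 'rV[R]_n => \prod_(i < n) F (lift ord0 i) (x ord0 i)).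
  apply: measurable_prod => i _.
  exact: measurableT_comp (measurable_coord i).
rewrite big_ord_recl -(IH (fun i => F (lift ord0 i)))//.
rewrite -ge0_integralZl//; last 3 first.
- exact/measurable_EFinP.
- by move=> x _; rewrite lee_fin prodr_ge0.
- by apply: integral_ge0 => x _; rewrite lee_fin.
apply: eq_integral => x _; rewrite /fubini_F/=.
rewrite muleC -ge0_integralZl//; last 3 first.
- by apply/measurable_EFinP; exact: mF.
- by move=> y _; rewrite lee_fin.
- by rewrite lee_fin prodr_ge0.
apply: eq_integral => y _; rewrite big_ord_recl row_cons0 -EFinM mulrC.
by congr (_ * _)%:E; apply: eq_bigr => i _; rewrite row_consS.
Qed.

End lebesgue_rV_theory.
Arguments leb : clear implicits.

(** * The heat semigroup *)

Section heat_semigroup.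
Context (R : realType).
Implicit Types (s t : R).

Lemma measurable_funVr d (T : measurableType d) (f : T -> R) :
  measurable_fun setT f -> measurable_fun setT (fun x => (f x)^-1).
Proof.
(* The square makes [powR] agree with the inverse also at negative values. *)
move=> mf; rewrite (_ : (fun x => _) = (fun x => f x * ((f x) ^+ 2) `^ (- 1))).
  apply: measurable_funM => //.
  by apply: (measurableT_comp (measurable_powR _)); exact: measurable_funX.
apply/funext => x; rewrite powR_inv1 ?sqr_ge0//.
have [->|fx0] := eqVneq (f x) 0; first by rewrite mul0r invr0.
by field.
Qed.

Definition gauss1 t (a : R) : R :=
  (2 * pi * t) `^ (- (1 / 2)) * expR (- (a ^+ 2 / (2 * t))).

Lemma gauss1_ge0 t a : 0 <= gauss1 t a.
Proof. by rewrite mulr_ge0 ?powR_ge0 ?expR_ge0. Qed.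

Lemma measurable_gauss1 d (T : measurableType d) (f g : T -> R) :
  measurable_fun setT f -> measurable_fun setT g ->
  measurable_fun setT (fun x => gauss1 (f x) (g x)).
Proof.
move=> mf mg; apply: measurable_funM.
  apply: (measurableT_comp (measurable_powR _)).
  by apply: measurable_funM => //; exact: measurable_cst.
apply: measurableT_comp => //; apply: measurableT_comp => //.
apply: measurable_funM; first exact: measurable_funX.
apply: measurable_funVr.
by apply: measurable_funM => //; exact: measurable_cst.
Qed.

Lemma gauss1_normal_pdf m t (a : R) : 0 < t ->
  gauss1 t (a - m) = normal_pdf m (Num.sqrt t) a.
Proof.
move=> t0; rewrite normal_pdfE ?gt_eqF ?sqrtr_gt0// /gauss1 /normal_peak /normal_fun.
rewrite sqr_sqrtr ?ltW// powRN -powR12_sqrt; last first.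
  by rewrite mulrn_wge0// mulr_ge0 ?ltW// pi_gt0.
have -> : 2 * pi * t = t * pi *+ 2 by rewrite -[RHS]mulr_natl (mulrC t) mulrA.
by rewrite mul1r mulNr -(mulr_natl t).
Qed.

Lemma integral_gauss1 m t : 0 < t ->
  (\int[lebesgue_measure]_a (gauss1 t (a - m))%:E = 1)%E.
Proof.
move=> t0; rewrite -[RHS](integral_normal_pdf m (Num.sqrt t)).
by apply: eq_integral => a _; rewrite gauss1_normal_pdf.
Qed.

(** Completing the square. The second factor is a shifted Gaussian in [y], so it
    integrates to 1: this is the Chapman-Kolmogorov equation in dimension 1. *)
Lemma gauss1_mul s t x y z : 0 < s -> 0 < t ->
  gauss1 s (y - x) * gauss1 t (z - y) = gauss1 (s + t) (z - x) *
    gauss1 (s * t / (s + t)) (y - (t * x + s * z) / (s + t)).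
Proof.
move=> s0 t0; rewrite /gauss1 mulrACA [RHS]mulrACA -!expRD.
have st0 : 0 < s + t by exact: addr_gt0.
have pi0 : 0 <= 2 * pi :> R by rewrite mulr_ge0 ?pi_ge0.
rewrite -!powRM ?(mulr_ge0 pi0) ?divr_ge0 ?mulr_ge0 ?ltW//.
congr (_ * expR _).
  congr (_ `^ _); rewrite mulrACA [RHS]mulrACA; congr (_ * _).
  by rewrite [RHS]mulrCA mulfV ?mulr1 ?gt_eqF.
rewrite -!opprD; congr (- _).
by field; rewrite ?gt_eqF.
Qed.

Context (n : nat).
Implicit Types (x y z : 'rV[R]_n) (g : 'rV[R]_n -> \bar R).

Lemma enorm_sqr x : enorm x ^+ 2 = \sum_(i < n) x ord0 i ^+ 2.
Proof. by rewrite /enorm sqr_sqrtr// sumr_ge0// => i _; exact: sqr_ge0. Qed.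

Lemma heat_kernel_prod t x : heat_kernel t x = \prod_(i < n) gauss1 t (x ord0 i).
Proof.
rewrite /heat_kernel /gauss1 big_split/= -expR_sum; congr (_ * expR _).
  rewrite prodr_const card_ord -powR_mulrn ?powR_ge0// -powRrM.
  by congr (_ `^ _); rewrite mulNr mul1r mulrC.
by rewrite sumrN -mulr_suml enorm_sqr.
Qed.

Lemma heat_kernel_ge0 t x : 0 <= heat_kernel t x.
Proof. by rewrite mulr_ge0 ?powR_ge0 ?expR_ge0. Qed.

Lemma measurable_heat_kernel d (T : measurableType d) (f : T -> R)
    (h k : T -> 'rV[R]_n) : measurable_fun setT f ->
  measurable_fun setT h -> measurable_fun setT k ->
  measurable_fun setT (fun a => heat_kernel (f a) (h a - k a)).
Proof.
move=> mf mh mk; under eq_fun do rewrite heat_kernel_prod.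
apply: measurable_prod => i _; apply: measurable_gauss1 => //.
under eq_fun do rewrite !mxE.
by apply: measurable_funB;
  [exact: measurableT_comp (measurable_coord i) mh
  |exact: measurableT_comp (measurable_coord i) mk].
Qed.

Lemma heat_kernel_convolution s t x z : 0 < s -> 0 < t ->
  (\int[leb R n]_y (heat_kernel s (y - x) * heat_kernel t (z - y))%:E =
   (heat_kernel (s + t) (z - x))%:E)%E.
Proof.
move=> s0 t0.
pose F i (a : R) := gauss1 s (a - x ord0 i) * gauss1 t (z ord0 i - a).
transitivity (\int[leb R n]_y (\prod_(i < n) F i (y ord0 i))%:E)%E.
  apply: eq_integral => y _; rewrite !heat_kernel_prod -big_split/=.
  by congr EFin; apply: eq_bigr => i _; rewrite !mxE.
rewrite (integral_rV_prod (F := F)); last 2 first.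
- move=> i; apply: measurable_funM; apply: measurable_gauss1 => //;
  exact: measurable_funB.
- by move=> i a; rewrite mulr_ge0// gauss1_ge0.
rewrite heat_kernel_prod -prodEFin; apply: eq_bigr => i _.
rewrite !mxE; set zx := gauss1 _ _.
under eq_integral do rewrite /F gauss1_mul// EFinM.
rewrite ge0_integralZl//; last 3 first.
- by apply/measurable_EFinP; apply: measurable_gauss1 => //; exact: measurable_funB.
- by move=> a _; rewrite lee_fin gauss1_ge0.
- by rewrite lee_fin gauss1_ge0.
by rewrite integral_gauss1 ?mule1// divr_gt0 ?mulr_gt0// addr_gt0.
Qed.

Lemma integral_heat_kernel t x : 0 < t ->
  (\int[leb R n]_y (heat_kernel t (y - x))%:E = 1)%E.
Proof.
move=> t0.
transitivity (\int[leb R n]_y (\prod_(i < n) gauss1 t (y ord0 i - x ord0 i))%:E)%E.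
  apply: eq_integral => y _; rewrite heat_kernel_prod.
  by congr EFin; apply: eq_bigr => i _; rewrite !mxE.
rewrite (integral_rV_prod (F := fun i a => gauss1 t (a - x ord0 i))); last 2 first.
- by move=> i; apply: measurable_gauss1 => //; exact: measurable_funB.
- by move=> i a; rewrite gauss1_ge0.
by rewrite big1// => i _; exact: integral_gauss1.
Qed.

(** The extended-real version of [heat]: it can be iterated, and Tonelli's theorem
    applies to it directly. *)
Definition heatE t g x : \bar R :=
  (\int[leb R n]_y ((heat_kernel t (y - x))%:E * g y))%E.

Lemma heat_heatE t (f : 'rV[R]_n -> R) x : heat t f x = heatE t (EFin \o f) x.
Proof. by []. Qed.

Let mhk t x : measurable_fun setT (fun y : 'rV[R]_n => (heat_kernel t (y - x))%:E).
Proof. by apply/measurable_EFinP; exact: measurable_heat_kernel. Qed.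

Lemma heatE_ge0 t g x : (forall y, 0 <= g y)%E -> (0 <= heatE t g x)%E.
Proof.
by move=> g0; apply: integral_ge0 => y _; rewrite mule_ge0// lee_fin heat_kernel_ge0.
Qed.

Lemma le_heatE t g1 g2 x : measurable_fun setT g1 -> measurable_fun setT g2 ->
  (forall y, 0 <= g1 y)%E -> (forall y, g1 y <= g2 y)%E ->
  (heatE t g1 x <= heatE t g2 x)%E.
Proof.
move=> m1 m2 g0 g12; apply: ge0_le_integral => //.
- by move=> y _; rewrite mule_ge0// lee_fin heat_kernel_ge0.
- exact: emeasurable_funM.
- exact: emeasurable_funM.
- by move=> y _; rewrite lee_wpmul2l// lee_fin heat_kernel_ge0.
Qed.

Lemma heatE_cst t (c : R) x : 0 < t -> 0 <= c -> heatE t (fun=> c%:E) x = c%:E.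
Proof.
move=> t0 c0; rewrite /heatE ge0_integralZr//; last first.
  by move=> y _; rewrite lee_fin heat_kernel_ge0.
by rewrite integral_heat_kernel// mul1e.
Qed.

Lemma heatED t g1 g2 x : measurable_fun setT g1 -> measurable_fun setT g2 ->
  (forall y, 0 <= g1 y)%E -> (forall y, 0 <= g2 y)%E ->
  heatE t (fun y => g1 y + g2 y)%E x = (heatE t g1 x + heatE t g2 x)%E.
Proof.
move=> m1 m2 g10 g20; rewrite /heatE -ge0_integralD//.
- by apply: eq_integral => y _; rewrite ge0_muleDr.
- by move=> y _; rewrite mule_ge0// lee_fin heat_kernel_ge0.
- exact: emeasurable_funM.
- by move=> y _; rewrite mule_ge0// lee_fin heat_kernel_ge0.
- exact: emeasurable_funM.
Qed.

Lemma heatEZ t (c : R) g x : 0 <= c -> measurable_fun setT g ->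
  (forall y, 0 <= g y)%E ->
  heatE t (fun y => c%:E * g y)%E x = (c%:E * heatE t g x)%E.
Proof.
move=> c0 mg g0; rewrite /heatE -ge0_integralZl//.
- by apply: eq_integral => y _; rewrite muleCA.
- exact: emeasurable_funM.
- by move=> y _; rewrite mule_ge0// lee_fin heat_kernel_ge0.
Qed.

(** The integrand may depend on the parameter [a]: the time integrals of the mild
    equation need joint measurability in time and space. *)
Lemma measurable_heatE d (T : measurableType d) (f : T -> R) (h : T -> 'rV[R]_n)
    (g : T -> 'rV[R]_n -> \bar R) :
  measurable_fun setT f -> measurable_fun setT h ->
  measurable_fun setT (fun p : T * 'rV[R]_n => g p.1 p.2) ->
  (forall a y, 0 <= g a y)%E ->
  measurable_fun setT (fun a => heatE (f a) (g a) (h a)).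
Proof.
move=> mf mh mg g0.
apply: (measurable_fun_fubini_tonelli_F (m2 := leb R n)
  (fun p : T * 'rV[R]_n => ((heat_kernel (f p.1) (p.2 - h p.1))%:E * g p.1 p.2)%E)).
  apply: emeasurable_funM => //; apply/measurable_EFinP.
  apply: measurable_heat_kernel => //.
  - exact: measurableT_comp.
  - exact: measurableT_comp.
by move=> p; rewrite mule_ge0// lee_fin heat_kernel_ge0.
Qed.

Lemma heatE_semigroup s t g x : 0 < s -> 0 < t -> measurable_fun setT g ->
  (forall y, 0 <= g y)%E -> heatE s (heatE t g) x = heatE (s + t) g x.
Proof.
move=> s0 t0 mg g0.
pose k (p : 'rV[R]_n * 'rV[R]_n) :=
  ((heat_kernel s (p.1 - x))%:E * ((heat_kernel t (p.2 - p.1))%:E * g p.2))%E.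
have mk : measurable_fun setT k.
  apply: emeasurable_funM.
    by apply/measurable_EFinP; apply: measurable_heat_kernel.
  apply: emeasurable_funM; last exact: measurableT_comp.
  by apply/measurable_EFinP; apply: measurable_heat_kernel.
have k0 p : (0 <= k p)%E by rewrite !mule_ge0// lee_fin heat_kernel_ge0.
transitivity (\int[leb R n]_y \int[leb R n]_z k (y, z))%E.
  apply: eq_integral => y _; rewrite /heatE -ge0_integralZl//.
  - by apply: emeasurable_funM.
  - by move=> z _; rewrite mule_ge0// lee_fin heat_kernel_ge0.
  - by rewrite lee_fin heat_kernel_ge0.
rewrite (fubini_tonelli (m1 := leb R n) (m2 := leb R n) k)//.
apply: eq_integral => z _; rewrite -(heat_kernel_convolution x z s0 t0).
rewrite -ge0_integralZr//.
- by apply: eq_integral => y _; rewrite /k/= muleA.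
- apply/measurable_EFinP; apply: measurable_funM; exact: measurable_heat_kernel.
- by move=> y _; rewrite lee_fin mulr_ge0// heat_kernel_ge0.
Qed.

Section time_integral.
Variables (D : set (measurableTypeR R)) (G : 'rV[R]_n * measurableTypeR R -> \bar R).
Hypotheses (mD : measurable D) (mG : measurable_fun setT G) (G0 : forall p, (0 <= G p)%E).

Let GD (p : 'rV[R]_n * measurableTypeR R) : \bar R := (G p * (\1_D p.2 : R)%:E)%E.

Let mGD : measurable_fun setT GD.
Proof.
apply: emeasurable_funM => //; apply/measurable_EFinP.
exact: (@measurableT_comp _ _ _ _ _ _ (\1_D : R -> R) _ snd).
Qed.

Let GD_ge0 p : (0 <= GD p)%E. Proof. by rewrite mule_ge0// lee_fin. Qed.

Let integralGD y : (\int[lebesgue_measure]_(r in D) G (y, r) =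
  \int[lebesgue_measure]_r GD (y, r))%E.
Proof. by rewrite integral_mkcond epatch_indic. Qed.

Lemma measurable_time_integral :
  measurable_fun setT (fun y => \int[lebesgue_measure]_(r in D) G (y, r))%E.
Proof.
under eq_fun do rewrite integralGD.
exact: (measurable_fun_fubini_tonelli_F (m2 := lebesgue_measure) GD).
Qed.

Lemma heatE_time_integral t x :
  (heatE t (fun y => \int[lebesgue_measure]_(r in D) G (y, r)) x =
   \int[lebesgue_measure]_(r in D) heatE t (fun y => G (y, r)) x)%E.
Proof.
pose k (p : 'rV[R]_n * measurableTypeR R) := ((heat_kernel t (p.1 - x))%:E * GD p)%E.
have mk : measurable_fun setT k.
  by apply: emeasurable_funM => //; apply/measurable_EFinP; exact: measurable_heat_kernel.
have k0 p : (0 <= k p)%E by rewrite mule_ge0// lee_fin heat_kernel_ge0.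
transitivity (\int[leb R n]_y \int[lebesgue_measure]_r k (y, r))%E.
  apply: eq_integral => y _; rewrite integralGD -ge0_integralZl//.
  - exact: (@measurableT_comp _ _ _ _ _ _ _ _ (pair y) mGD).
  - by rewrite lee_fin heat_kernel_ge0.
transitivity (\int[lebesgue_measure]_r \int[leb R n]_y k (y, r))%E.
  exact: (@fubini_tonelli _ _ _ _ _ (leb R n) lebesgue_measure k mk k0).
rewrite [RHS]integral_mkcond epatch_indic; apply: eq_integral => r _.
rewrite /k /GD /= indicE; case: (r \in D) => /=.
  by rewrite mule1; apply: eq_integral => y _; rewrite mule1.
by rewrite mule0; apply: integral0_eq => y _; rewrite !mule0.
Qed.

End time_integral.

End heat_semigroup.

(** * Mild solutions along backward Brownian paths *)

Section mild_solutions.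
Context (R : realType) (n : nat).
Variables (psi : R -> R) (f : 'rV[R]_n -> R) (v : R -> 'rV[R]_n -> R).
Hypotheses (mpsi : measurable_fun setT psi)
  (psi_ge0 : forall l, 0 <= l -> 0 <= psi l)
  (mf : measurable_fun setT f) (f_ge0 : forall x, 0 <= f x)
  (sol : mild_solution psi f v).
Local Open Scope ereal_scope.

Lemma measurable_mild d (T : measurableType d) (tau : T -> R) (h : T -> 'rV[R]_n) :
  measurable_fun setT tau -> measurable_fun setT h -> (forall a, 0 <= tau a)%R ->
  measurable_fun setT (fun a => v (tau a) (h a)).
Proof.
move=> mtau mh tau0.
have mD : measurable [set tx : R * 'rV[R]_n | (0 <= tx.1)%R].
  rewrite [X in measurable X](_ : _ = `[0%R, +oo[%classic `*` setT).
    exact: measurableX.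
  by apply/seteqP; split => [[a b]|[a b]]/=; rewrite in_itv/= andbT// => -[].
apply: (measurable_comp mD (g := fun a => (tau a, h a))
  (f := fun tx : R * 'rV[R]_n => v tx.1 tx.2)).
- by move=> _ [a _ <-] /=; exact: tau0.
- exact: mild_measurable sol.
- exact: measurable_fun_pair.
Qed.

Lemma measurable_mild_slice t : (0 <= t)%R -> measurable_fun setT (v t).
Proof. by move=> t0; exact: (@measurable_mild _ _ (fun=> t) id). Qed.

(** The nonlinear term. The clipping at time 0 makes it measurable on the whole
    time axis, while [v] is measurable for nonnegative times only. *)
Let w (s : R) (y : 'rV[R]_n) : \bar R := (psi (v (Num.max 0 s) y))%:E.

Let w_ge0 s y : 0 <= w s y.
Proof. by rewrite lee_fin psi_ge0// (mild_ge0 sol)// le_max lexx. Qed.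

Let mw d (T : measurableType d) (tau : T -> R) (h : T -> 'rV[R]_n) :
  measurable_fun setT tau -> measurable_fun setT h ->
  measurable_fun setT (fun a => w (tau a) (h a)).
Proof.
move=> mtau mh; apply/measurable_EFinP; apply: measurableT_comp => //.
apply: measurable_mild => //; last by move=> a; rewrite le_max lexx.
by apply: measurable_maxr => //.
Qed.

Let mwt s : measurable_fun setT (w s). Proof. exact: (@mw _ _ (fun=> s) id). Qed.

(** The rate at which mass is lost at time [r], seen from [x] at time [t]: the
    integrand of the mild equation. *)
Definition absorption (t : R) (x : 'rV[R]_n) (r : R) : \bar R := heatE (t - r) (w r) x.

Lemma absorption_ge0 t x r : 0 <= absorption t x r.
Proof. exact: heatE_ge0. Qed.

Lemma measurable_absorption d (T : measurableType d) (tau : T -> R)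
    (h : T -> 'rV[R]_n) (s : T -> R) :
  measurable_fun setT tau -> measurable_fun setT h -> measurable_fun setT s ->
  measurable_fun setT (fun a => absorption (tau a) (h a) (s a)).
Proof.
move=> mtau mh ms; apply: (@measurable_heatE _ _ _ _ (fun a => tau a - s a)%R h (fun a => w (s a))) => //.
- exact: measurable_funB.
- by apply: mw => //; exact: measurableT_comp.
Qed.

(** The difference in the mild equation is the finite number [v t x], so neither
    of its terms is infinite and the absorption can be moved to the left. *)
Lemma mild_eqD t x : (0 < t)%R ->
  (v t x)%:E + \int[lebesgue_measure]_(r in `]0%R, t[) absorption t x r =
  heatE t (EFin \o f) x.
Proof.
move=> t0; have := mild_eq sol x t0; rewrite heat_heatE.
have -> : \int[lebesgue_measure]_(s in `]0%R, t[) heat (t - s) (fun y => psi (v s y)) x =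
   \int[lebesgue_measure]_(r in `]0%R, t[) absorption t x r.
  apply: eq_integral => s; rewrite inE/= in_itv/= => /andP[s0 _].
  rewrite heat_heatE /absorption; congr heatE; apply/funext => y.
  by rewrite /w max_r// ltW.
move=> e; rewrite e subeK//.
have : heatE t (EFin \o f) x - \int[lebesgue_measure]_(r in `]0%R, t[) absorption t x r
    \is a fin_num by rewrite -e.
by rewrite fin_numB => /andP[].
Qed.

Lemma mild_le_heat t x : (0 < t)%R -> (v t x)%:E <= heatE t (EFin \o f) x.
Proof.
move=> t0; rewrite -mild_eqD// leeDl// integral_ge0// => r _.
exact: absorption_ge0.
Qed.

Lemma heatE_integral_absorption s t x : (0 < s < t)%R ->
  heatE (t - s) (fun y => \int[lebesgue_measure]_(r in `]0%R, s[) absorption s y r) x =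
  \int[lebesgue_measure]_(r in `]0%R, s[) absorption t x r.
Proof.
move=> /andP[s0 st].
transitivity (\int[lebesgue_measure]_(r in `]0%R, s[)
    heatE (t - s) (fun y => absorption s y r) x).
  apply: (@heatE_time_integral _ _ _ (fun p => absorption s p.1 p.2)) => //.
  - exact: (@measurable_absorption _ _ (fun=> s) fst snd).
  - by move=> p; exact: absorption_ge0.
apply: eq_integral => r; rewrite inE/= in_itv/= => /andP[r0 rs].
transitivity (heatE (t - s + (s - r)) (w r) x); last by rewrite addrA subrK.
by apply: heatE_semigroup => //; rewrite subr_gt0.
Qed.

(** The mean of [v] along a Brownian path that leaves [x] at time [t] and runs
    backwards to time [r]; [r = t] is a separate case because [heatE] has no
    meaning at time 0. *)
Definition backward_mean t x r : \bar R :=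
  if (r < t)%R then heatE (t - r) (EFin \o v r) x else (v t x)%:E.

Lemma backward_mean_ge0 t x r : (0 <= r <= t)%R -> 0 <= backward_mean t x r.
Proof.
move=> /andP[r0 rt]; rewrite /backward_mean; case: ifPn => _.
  by apply: heatE_ge0 => y; rewrite lee_fin (mild_ge0 sol).
by rewrite lee_fin (mild_ge0 sol)// (le_trans r0).
Qed.

(** The mild equation at time [r], averaged by the heat semigroup over the
    remaining time [t - r]. So the backward mean only decreases, and at the rate
    [absorption]. *)
Lemma backward_meanD t x r : (0 < r <= t)%R ->
  backward_mean t x r + \int[lebesgue_measure]_(q in `]0%R, r[) absorption t x q =
  heatE t (EFin \o f) x.
Proof.
move=> /andP[r0]; rewrite /backward_mean le_eqVlt => /predU1P[<-|rt].
  by rewrite ltxx mild_eqD.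
rewrite rt -heatE_integral_absorption ?r0//.
have mabs : measurable_fun setT
    (fun y => \int[lebesgue_measure]_(q in `]0%R, r[) absorption r y q).
  apply: (@measurable_time_integral _ _ `]0%R, r[%classic (fun p => absorption r p.1 p.2)) => //.
  - exact: (@measurable_absorption _ _ (fun=> r) fst snd).
  - by move=> p; exact: absorption_ge0.
rewrite -heatED//; last 3 first.
- by apply/measurable_EFinP; apply: measurable_mild_slice; exact: ltW.
- by move=> y; rewrite lee_fin (mild_ge0 sol)// ltW.
- by move=> y; apply: integral_ge0 => q _; exact: absorption_ge0.
under [X in heatE _ X _]eq_fun do rewrite mild_eqD//.
transitivity (heatE (t - r + r) (EFin \o f) x); last by rewrite subrK.
apply: heatE_semigroup => //; first by rewrite subr_gt0.
exact/measurable_EFinP.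
Qed.

Hypothesis f_bounded : exists B, forall x, (f x <= B)%R.

Lemma heatE_init_fin_num t x : (0 < t)%R -> heatE t (EFin \o f) x \is a fin_num.
Proof.
move=> t0; have [B fB] := f_bounded; rewrite ge0_fin_numE; last first.
  by apply: heatE_ge0 => y; rewrite lee_fin.
apply: (@le_lt_trans _ _ (heatE t (fun=> B%:E) x)); last first.
  by rewrite heatE_cst ?ltry// (le_trans (f_ge0 x) (fB x)).
apply: le_heatE => //; first exact/measurable_EFinP.
Qed.

Lemma backward_mean_fin_num t x r : (0 < r <= t)%R -> backward_mean t x r \is a fin_num.
Proof.
move=> /andP[r0 rt]; rewrite ge0_fin_numE; last by rewrite backward_mean_ge0// (ltW r0).
apply: (@le_lt_trans _ _ (heatE t (EFin \o f) x)).
  rewrite -(backward_meanD x (r := r)) ?r0// leeDl// integral_ge0// => q _.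
  exact: absorption_ge0.
by rewrite ltey_eq heatE_init_fin_num// (lt_le_trans r0).
Qed.

Lemma backward_meanB t x s r : (0 < s)%R -> (s <= r)%R -> (r <= t)%R ->
  backward_mean t x r + \int[lebesgue_measure]_(q in `[s, r[) absorption t x q =
  backward_mean t x s.
Proof.
move=> s0 sr rt; have r0 := lt_le_trans s0 sr; have st := le_trans sr rt.
have := @backward_meanD t x r; rewrite r0 rt => /(_ isT) er.
have := @backward_meanD t x s; rewrite s0 st => /(_ isT) es.
have mabs : measurable_fun setT (absorption t x).
  exact: (@measurable_absorption _ _ (fun=> t) (fun=> x) id).
move: er; rewrite -es.
have -> : (`]0%R, r[ = `]0%R, s[ `|` `[s, r[)%classic.
  by rewrite -itv_bndbnd_setU// bnd_simp// ltW.
rewrite ge0_integral_setU//=; last 3 first.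
- exact: measurable_funTS.
- by move=> q _; exact: absorption_ge0.
- apply/disj_setPLR => q /=; rewrite !in_itv/= => /andP[_ qs].
  by rewrite leNgt qs.
move=> er; pose I1 := \int[lebesgue_measure]_(q in `]0%R, s[) absorption t x q.
have I1fin : I1 \is a fin_num.
  have := heatE_init_fin_num x (lt_le_trans s0 st); rewrite -es fin_numD.
  by case/andP.
by move: er => /(congr1 (fun z => z - I1)); rewrite -/I1 addeCA (addeC I1) !addeK.
Qed.

Lemma backward_mean_noninc t x s r : (0 < s)%R -> (s <= r)%R -> (r <= t)%R ->
  backward_mean t x r <= backward_mean t x s.
Proof.
move=> s0 sr rt; rewrite -(backward_meanB x s0 sr rt) leeDl// integral_ge0// => q _.
exact: absorption_ge0.
Qed.

Lemma mild_le_heat_mild s t x : (0 < s < t)%R ->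
  (v t x)%:E <= heatE (t - s) (EFin \o v s) x.
Proof.
move=> /andP[s0 st]; have := @backward_mean_noninc t x s t s0 (ltW st) (lexx _).
by rewrite /backward_mean ltxx st.
Qed.

End mild_solutions.

(** * Decay in time, uniform in the initial value *)

Section decay.
Context (R : realType).
Implicit Types (phi : R -> R).

Lemma powR1D (b z : R) : 0 <= b -> 0 <= z -> z `^ (1 + b) = z `^ b * z.
Proof.
move=> b0 z0; rewrite powRD ?powRr1 1?mulrC//.
by rewrite gt_eqF// ltr_pwDl.
Qed.

(** For [y <= m] the left side is at most [m `^ (1 + b)], for [m <= y] it is at most
    [y `^ (1 + b)]. *)
Lemma powR_sub_le (b m y : R) : 0 <= b -> 0 <= m -> 0 <= y ->
  m `^ b * y <= y `^ (1 + b) + m `^ (1 + b).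
Proof.
move=> b0 m0 y0; rewrite !powR1D//; have [ym|my] := leP y m.
  by rewrite -[leLHS]add0r lerD ?mulr_ge0 ?powR_ge0// ler_wpM2l ?powR_ge0.
rewrite -[leLHS]addr0 lerD ?mulr_ge0 ?powR_ge0// ler_wpM2r ?ge0_ler_powR ?nnegrE//.
exact: ltW.
Qed.

(** A bounded function that loses a fixed proportion of [s * phi s `^ (1 + b)] over
    every dyadic interval decays like [s `^ (- b^-1)]: if the bound failed at [s] it
    would fail at all [s / 2 ^ k], where it exceeds every constant. *)
Lemma dyadic_decay phi (b k B t : R) : 0 < b -> b <= 1 -> 0 < k -> 0 < t ->
  (forall s, 0 < s <= t -> 0 <= phi s <= B) ->
  (forall s, 0 < s <= t -> phi s + k * s * phi s `^ (1 + b) <= phi (s / 2)) ->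
  phi t <= (2 `^ b^-1 / k) `^ b^-1 * t `^ (- b^-1).
Proof.
move=> b0 b1 k0 t0 phiB dphi; set M := (2 `^ b^-1 / k) `^ b^-1.
have M0 : 0 < M by rewrite powR_gt0 ?divr_gt0 ?powR_gt0.
have bN0 : b != 0 by rewrite gt_eqF.
have step s : 0 < s <= t -> M * s `^ (- b^-1) < phi s ->
    M * (s / 2) `^ (- b^-1) < phi (s / 2).
  move=> /[dup] st /andP[s0 _] lt; apply: lt_le_trans (dphi _ st).
  have phi0 : 0 < phi s.
    by apply: le_lt_trans lt; rewrite mulr_ge0 ?powR_ge0 ?ltW.
  rewrite powR1D ?(ltW b0) ?(ltW phi0)// mulrA -[X in X + _]mul1r -mulrDl [ltRHS]mulrC.
  rewrite powRM ?invr_ge0 ?ltW// mulrA.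
  have -> : (2^-1 : R) `^ (- b^-1) = 2 `^ b^-1.
    by rewrite -powR_inv1// -powRrM mulrN mulNr mul1r opprK.
  apply: (lt_le_trans (y := phi s * 2 `^ b^-1)).
    by rewrite ltr_pM2r// powR_gt0.
  rewrite ler_pM2l// -[leLHS]add0r lerD//.
  have : (M * s `^ (- b^-1)) `^ b <= phi s `^ b.
    by rewrite ge0_ler_powR ?nnegrE ?(ltW b0) ?(ltW lt) ?mulr_ge0 ?powR_ge0 ?ltW.
  rewrite powRM ?powR_ge0 ?(ltW M0)// -!powRrM mulNr mulVf// powRr1; last first.
    by rewrite divr_ge0 ?powR_ge0 ?ltW.
  rewrite powR_inv1 ?(ltW s0)//.
  move=> h; rewrite -ler_pdivrMl ?mulr_gt0//.
  by apply: le_trans h; rewrite invfM mulrC mulrA.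
rewrite leNgt; apply/negP => lt.
have all n : M * (t / 2 ^+ n) `^ (- b^-1) < phi (t / 2 ^+ n).
  elim: n => [|n IH]; first by rewrite expr0 divr1.
  rewrite exprSr invfM mulrA; apply: step => //.
  rewrite divr_gt0 ?exprn_gt0//= ler_pdivrMr ?exprn_gt0//.
  by rewrite ler_pMr// exprn_ege1// ler1n.
pose c := M * t `^ (- b^-1).
have c0 : 0 < c by apply: mulr_gt0 => //; exact: powR_gt0.
have cB n : c * n%:R <= B.
  have tn : 0 < t / 2 ^+ n <= t.
    rewrite divr_gt0 ?exprn_gt0//= ler_pdivrMr ?exprn_gt0//.
    by rewrite ler_pMr// exprn_ege1// ler1n.
  have /andP[_ le2] := phiB _ tn.
  apply: le_trans (le_trans (ltW (all n)) le2).
  rewrite powRM ?invr_ge0 ?exprn_ge0 ?(ltW t0)// mulrA ler_wpM2l ?(ltW c0)//.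
  rewrite -powR_inv1 ?exprn_ge0// -powRrM mulrN mulNr mul1r opprK.
  apply: (@le_trans _ _ (2 ^+ n)).
    by rewrite -natrX ler_nat ltnW// ltn_expl.
  by rewrite le1r_powR ?exprn_ege1 ?ler1n// invf_ge1.
have B0 : 0 <= B / c.
  by rewrite divr_ge0 ?(ltW c0)//; have := cB 0; rewrite mulr0.
have := archi_boundP B0.
by rewrite ltr_pdivrMr// mulrC ltNge cB.
Qed.

End decay.

Section mild_decay.
Context (R : realType) (n : nat).
Variables (psi : R -> R) (f : 'rV[R]_n -> R) (v : R -> 'rV[R]_n -> R).
Hypotheses (mpsi : measurable_fun setT psi)
  (psi_ge0 : forall l, 0 <= l -> 0 <= psi l)
  (mf : measurable_fun setT f) (f_ge0 : forall x, 0 <= f x)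
  (f_bounded : exists B, forall x, f x <= B)
  (sol : mild_solution psi f v).
Variables (b k0 : R).
Hypotheses (b_gt0 : 0 < b) (b_le1 : b <= 1) (k0_gt0 : 0 < k0)
  (psi_lb : forall l, 0 <= l -> k0 * l `^ (1 + b) <= psi l).

Let mvt t : 0 <= t -> measurable_fun setT (EFin \o v t).
Proof. by move=> t0; apply/measurable_EFinP; exact: (measurable_mild_slice sol). Qed.

(** Jensen's inequality up to a constant: averaging [powR_sub_le], with [m] half
    the mean of [v r], leaves [m `^ (1 + b)]. *)
Lemma absorption_lb t x r a : 0 <= r < t ->
  heatE (t - r) (EFin \o v r) x = a%:E -> 0 <= a ->
  ((k0 * (a / 2) `^ (1 + b))%:E <= absorption psi v t x r)%E.
Proof.
move=> /andP[r0 rt] ea a0; set m := a / 2; have m0 : 0 <= m by rewrite divr_ge0.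
have tr0 : 0 < t - r by rewrite subr_gt0.
have v0 y : 0 <= v r y by exact: (mild_ge0 sol).
have mvb : measurable_fun setT (fun y => (v r y `^ (1 + b))%:E).
  apply/measurable_EFinP; apply: (measurableT_comp (measurable_powR _)).
  exact: (measurable_mild_slice sol).
have low : ((m `^ (1 + b))%:E <= heatE (t - r) (fun y => (v r y `^ (1 + b))%:E) x)%E.
  have : ((m `^ b * a)%:E <=
      heatE (t - r) (fun y => (v r y `^ (1 + b))%:E) x + (m `^ (1 + b))%:E)%E.
    rewrite -[X in (_ <= _ + X)%E](heatE_cst x tr0) ?powR_ge0// -heatED//; last 2 first.
    - by move=> y; rewrite lee_fin powR_ge0.
    - by move=> y; rewrite lee_fin powR_ge0.
    rewrite EFinM -ea -heatEZ ?powR_ge0//; last exact: (mvt r0).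
    apply: le_heatE => //.
    - by apply: emeasurable_funM => //; exact: (mvt r0).
    - by apply: emeasurable_funD.
    - by move=> y; rewrite mule_ge0// lee_fin ?powR_ge0.
    - by move=> y; rewrite -EFinM -EFinD lee_fin powR_sub_le// ltW.
  have -> : m `^ b * a = m `^ (1 + b) + m `^ (1 + b).
    by rewrite (powR1D (ltW b_gt0) m0) -mulrDr /m -splitr.
  by rewrite EFinD leeD2rE.
apply: (@le_trans _ _ (heatE (t - r) (fun y => k0%:E * (v r y `^ (1 + b))%:E)%E x)).
  rewrite heatEZ ?(ltW k0_gt0)//; last by move=> y; rewrite lee_fin powR_ge0.
  by rewrite EFinM lee_wpmul2l// lee_fin ltW.
rewrite /absorption max_r//; apply: le_heatE => //.
- exact: emeasurable_funM.
- apply/measurable_EFinP; apply: measurableT_comp => //.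
  exact: (measurable_mild_slice sol).
- by move=> y; rewrite mule_ge0// lee_fin ?powR_ge0// ltW.
- by move=> y; rewrite -EFinM lee_fin psi_lb.
Qed.

Definition decay_const : R := (2 `^ b^-1 / (k0 / (2 * 2 `^ (1 + b)))) `^ b^-1.

Lemma decay_const_ge0 : 0 <= decay_const. Proof. exact: powR_ge0. Qed.

(** Along a backward Brownian path the mean of [v] satisfies the integrated form of
    [u' <= - k * u `^ (1 + b)], so it decays as if started at infinity, whatever
    the initial value. *)
Lemma mild_decay t x : 0 < t -> v t x <= decay_const * t `^ (- b^-1).
Proof.
move=> t0; have [B fB] := f_bounded.
pose phi s := fine (backward_mean v t x s).
have phiE s : 0 < s <= t -> backward_mean v t x s = (phi s)%:E.
  move=> st; rewrite /phi fineK//.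
    exact: (backward_mean_fin_num mpsi psi_ge0 mf f_ge0 sol f_bounded).
have phi_ge0 s : 0 < s <= t -> 0 <= phi s.
  move=> st; rewrite -lee_fin -phiE//; apply: (backward_mean_ge0 sol).
  by case/andP : st => /ltW ->.
rewrite (_ : v t x = phi t); last by rewrite /phi /backward_mean ltxx.
apply: (@dyadic_decay _ phi b _ B) => //.
- by rewrite divr_gt0// mulr_gt0// powR_gt0.
- move=> s st; rewrite phi_ge0//= -lee_fin -phiE//.
  apply: (@le_trans _ _ (heatE t (EFin \o f) x)).
    rewrite -(backward_meanD mpsi psi_ge0 mf f_ge0 sol x st) leeDl//.
    by apply: integral_ge0 => q _; exact: (absorption_ge0 psi_ge0 sol).
  rewrite -[leRHS](heatE_cst x t0); last exact: le_trans (f_ge0 x) (fB x).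
  by apply: le_heatE => //; exact/measurable_EFinP.
- move=> s /andP[s0 st]; have sph : 0 < s <= t by rewrite s0.
  have s20 : 0 < s / 2 by rewrite divr_gt0.
  have s2s : s / 2 <= s by rewrite ler_pdivrMr// ler_pMr// ler1n.
  have s2t : 0 < s / 2 <= t by rewrite s20 (le_trans s2s).
  rewrite -lee_fin EFinD -!phiE//.
  rewrite -(backward_meanB mpsi psi_ge0 mf f_ge0 sol f_bounded x s20 s2s st).
  rewrite leeD2lE ?phiE//.
  apply: (@le_trans _ _ (\int[lebesgue_measure]_(q in `[(s / 2)%R, s[)
      (k0 * (phi s / 2) `^ (1 + b))%R%:E)%E).
    rewrite integral_cst//= lebesgue_measure_itv/= lte_fin.
    have -> : s / 2 < s by rewrite ltr_pdivrMr// ltr_pMr// ltr1n.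
    rewrite -EFinB -EFinM lee_fin powRM ?phi_ge0//.
    have -> : (2^-1 : R) `^ (1 + b) = (2 `^ (1 + b))^-1.
      by rewrite -powR_inv1// -powRrM mulN1r powRN.
    rewrite invfM [X in X - _](splitr s) addrK le_eqVlt; apply/orP; left.
    apply/eqP; ring.
  apply: ge0_le_integral => //.
  + by move=> q _; rewrite lee_fin mulr_ge0 ?powR_ge0// ltW.
  + apply: measurable_funTS.
    exact: (@measurable_absorption _ _ _ _ _ mpsi psi_ge0 sol _ _ (fun=> t) (fun=> x) id).
  + move=> q /=; rewrite in_itv/= => /andP[sq qs].
    have q0 : 0 < q by exact: lt_le_trans sq.
    have qt : q < t by exact: lt_le_trans st.
    have qq : 0 < q <= t by rewrite q0 ltW.
    apply: (@le_trans _ _ (k0 * (phi q / 2) `^ (1 + b))%:E).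
      rewrite lee_fin; apply: ler_wpM2l; first exact: ltW.
      apply: ge0_ler_powR; first by rewrite addr_ge0// ltW.
      - by rewrite nnegrE divr_ge0// phi_ge0.
      - by rewrite nnegrE divr_ge0// phi_ge0.
      rewrite ler_pM2r ?invr_gt0// -lee_fin -!phiE//.
      exact: (backward_mean_noninc mpsi psi_ge0 mf f_ge0 sol f_bounded x q0 (ltW qs) st).
    apply: absorption_lb; first by rewrite ltW.
    - by rewrite -phiE// /backward_mean qt.
    - exact: phi_ge0.
Qed.

End mild_decay.

(** * Euclidean balls and Gaussian comparisons *)

Section ball_estimates.
Context (R : realType) (n : nat).
Implicit Types (x y z : 'rV[R]_n) (r s t a b : R).

Lemma enorm_ge0 x : 0 <= enorm x. Proof. exact: sqrtr_ge0. Qed.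

Lemma enormN x : enorm (- x) = enorm x.
Proof. by rewrite /enorm; under eq_bigr do rewrite mxE sqrrN. Qed.

(** Young's inequality in each coordinate. With a suitable [e] it yields every
    comparison of norms that is needed, the triangle inequality included. *)
Lemma enorm_sqrD_le (e : R) x y : 0 < e ->
  enorm (x + y) ^+ 2 <= (1 + e) * enorm x ^+ 2 + (1 + e^-1) * enorm y ^+ 2.
Proof.
move=> e0; rewrite !enorm_sqr !mulr_sumr -big_split/=; apply: ler_sum => i _.
rewrite mxE; set a := x ord0 i; set b := y ord0 i; rewrite -subr_ge0.
have -> : (1 + e) * a ^+ 2 + (1 + e^-1) * b ^+ 2 - (a + b) ^+ 2 =
    e^-1 * (e * a - b) ^+ 2 by field; rewrite gt_eqF.
by rewrite mulr_ge0 ?sqr_ge0// invr_ge0 ltW.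
Qed.

Lemma enorm_sqrB_le (e : R) x y : 0 < e ->
  enorm (y - x) ^+ 2 <= (1 + e) * enorm x ^+ 2 + (1 + e^-1) * enorm y ^+ 2.
Proof. by move=> e0; rewrite addrC -(enormN x) enorm_sqrD_le. Qed.

Lemma enorm_sqr_le (e : R) x y : 0 < e ->
  enorm x ^+ 2 <= (1 + e) * enorm y ^+ 2 + (1 + e^-1) * enorm (y - x) ^+ 2.
Proof. by move=> e0; rewrite -(enormN (y - x)) opprB -{1}(subrKC y x) enorm_sqrD_le. Qed.

(** The choice [1 + e = a / b] in [enorm_sqr_le] is optimal and gives the exact
    triangle inequality. *)
Lemma enorm_sqrB_ge a b x y : 0 < b -> b < a -> a <= enorm x -> enorm y < b ->
  (a - b) ^+ 2 <= enorm (y - x) ^+ 2.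
Proof.
move=> b0 ba ax yb; have ab0 : 0 < a - b by rewrite subr_gt0.
have a0 : 0 < a by exact: lt_trans ba.
have := @enorm_sqr_le ((a - b) / b) x y (divr_gt0 ab0 b0).
have -> : 1 + (a - b) / b = a / b by field; rewrite gt_eqF.
have -> : 1 + ((a - b) / b)^-1 = a / (a - b) by field; rewrite !gt_eqF.
have x2 : a ^+ 2 <= enorm x ^+ 2 by rewrite lerXn2r ?nnegrE ?enorm_ge0// ltW.
have y2 : enorm y ^+ 2 <= b ^+ 2.
  by rewrite lerXn2r ?nnegrE ?enorm_ge0// ltW.
move=> h; have : a ^+ 2 <= a / b * b ^+ 2 + a / (a - b) * enorm (y - x) ^+ 2.
  apply: (le_trans x2); apply: (le_trans h); rewrite lerD2r ler_pM2l//.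
  exact: divr_gt0.
rewrite -lerBlDl -ler_pdivrMl ?divr_gt0//.
suff -> : (a / (a - b))^-1 * (a ^+ 2 - a / b * b ^+ 2) = (a - b) ^+ 2 by [].
by field; rewrite !gt_eqF.
Qed.

Lemma powRN_le (p k a b : R) : 0 <= p -> 0 < a -> 0 < k -> a <= k * b ->
  b `^ (- p) <= k `^ p * a `^ (- p).
Proof.
move=> p0 a0 k0 akb.
have b0 : 0 < b by rewrite -(pmulr_rgt0 _ k0) (lt_le_trans a0).
rewrite !powRN ler_pdivlMr ?powR_gt0// mulrC ler_pdivrMr ?powR_gt0//.
rewrite -powRM ?(ltW b0) ?(ltW k0)//.
by apply: ge0_ler_powR; rewrite ?nnegrE ?mulr_ge0 ?(ltW a0) ?(ltW b0) ?(ltW k0).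
Qed.

Let half_ge0 : 0 <= n%:R / 2 :> R. Proof. by rewrite divr_ge0. Qed.
Let pi2_gt0 : 0 < 2 * pi :> R. Proof. by rewrite mulr_gt0// pi_gt0. Qed.

Lemma heat_kernel_le_peak s z : 0 <= s ->
  heat_kernel s z <= (2 * pi * s) `^ (- (n%:R / 2)).
Proof.
move=> s0; rewrite /heat_kernel ler_piMr ?powR_ge0//.
by rewrite -expR0 ler_expR oppr_le0 divr_ge0 ?sqr_ge0 ?mulr_ge0.
Qed.

(** Reduces the Gaussian comparisons below to inequalities between squared
    norms. *)
Lemma le_heat_kernel s t (k e : R) x y : 0 < t -> 0 < k -> t <= k * s ->
  enorm y ^+ 2 / (2 * t) <= e + enorm x ^+ 2 / (2 * s) ->
  heat_kernel s x <= k `^ (n%:R / 2) * expR e * heat_kernel t y.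
Proof.
move=> t0 k0 tks h; rewrite /heat_kernel mulrACA; apply: ler_pM.
- exact: powR_ge0.
- exact: expR_ge0.
- apply: powRN_le => //; first by rewrite mulr_gt0.
  by rewrite mulrCA ler_pM2l.
by rewrite -expRD ler_expR lerBrDr addrC lerBlDr.
Qed.

(** Half of the Gaussian exponent pays for replacing [s] by [t]; the other half is
    the gain [dl / (4 * s)]. *)
Lemma heat_kernel_far s t (dl : R) z : 0 < s -> 2 * s <= t -> t <= 3 * s ->
  dl <= enorm z ^+ 2 ->
  heat_kernel s z <= 3 `^ (n%:R / 2) * expR (- (dl / (4 * s))) * heat_kernel t z.
Proof.
move=> s0 s2 s3 dz; have t0 : 0 < t by apply: lt_le_trans s2; rewrite mulr_gt0.
apply: le_heat_kernel => //.
apply: (@le_trans _ _ (enorm z ^+ 2 / (4 * s))).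
  rewrite ler_wpM2l ?sqr_ge0// lef_pV2 ?posrE ?mulr_gt0//.
  by rewrite (_ : 4 * s = 2 * (2 * s)) ?ler_pM2l//; ring.
rewrite (_ : enorm z ^+ 2 / (2 * s) = enorm z ^+ 2 / (4 * s) + enorm z ^+ 2 / (4 * s)).
  by rewrite addrA lerDr addrC subr_ge0 ler_pM2r// invr_gt0 mulr_gt0.
by field; rewrite gt_eqF.
Qed.

(** Doubling the time in the target leaves room in the exponent for the
    displacement [y] and for times up to [3 / 2 * t]. *)
Lemma heat_kernel_upper t tau (e : R) x y : 0 < e -> e ^+ 2 <= t ->
  t <= tau -> tau <= 3 / 2 * t -> enorm y < 2 * e ->
  heat_kernel tau (y - x) <= 2 `^ (n%:R / 2) * expR 4 * heat_kernel (2 * t) x.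
Proof.
move=> e0 et t1 t2 ye; have t0 : 0 < t by apply: lt_le_trans et; rewrite exprn_gt0.
apply: le_heat_kernel => //; first by rewrite mulr_gt0.
  by rewrite ler_pM2l.
have := enorm_sqr_le x y (e := 3) (ltr0Sn _ _).
set X := enorm x ^+ 2; set Y := enorm y ^+ 2; set Z := enorm _ ^+ 2 => h.
have Y4 : Y <= 4 * t.
  apply: (@le_trans _ _ (4 * e ^+ 2)); last by rewrite ler_pM2l.
  rewrite (_ : 4 * e ^+ 2 = (2 * e) ^+ 2); last by ring.
  by rewrite lerXn2r ?nnegrE ?enorm_ge0 ?mulr_ge0// ltW.
have tau0 : 0 < tau by exact: lt_le_trans t1.
apply: (@le_trans _ _ (4 + Z / (3 * t))); last first.
  rewrite lerD2l ler_wpM2l ?sqr_ge0// lef_pV2 ?posrE ?mulr_gt0//.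
  by rewrite -ler_pdivlMl// mulrA (mulrC 2^-1).
rewrite ler_pdivrMr ?mulr_gt0//.
rewrite (_ : (4 + Z / (3 * t)) * (2 * (2 * t)) = 16 * t + 4 / 3 * Z); last first.
  by field; rewrite gt_eqF.
move: h; rewrite (_ : 1 + 3^-1 = 4 / 3 :> R); last by field.
by lra.
Qed.

(** Shrinking the time by the factor [b / (1 + b)] makes room in the exponent:
    [enorm (y - x) ^+ 2 <= (1 + b^-1) * enorm x ^+ 2 + (1 + b) * enorm y ^+ 2]. *)
Lemma heat_kernel_lower (b : R) t (e : R) x y : 0 < b -> 0 < e -> e ^+ 2 <= t ->
  enorm y < e ->
  heat_kernel (b * t / (1 + b)) x <=
    ((1 + b) / b) `^ (n%:R / 2) * expR ((1 + b) / 2) * heat_kernel t (y - x).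
Proof.
move=> b0 e0 et ye; have t0 : 0 < t by apply: lt_le_trans et; rewrite exprn_gt0.
have b10 : 0 < 1 + b by rewrite addr_gt0.
apply: le_heat_kernel => //; first by rewrite divr_gt0.
  by rewrite le_eqVlt; apply/orP; left; apply/eqP; field; rewrite !gt_eqF.
have := enorm_sqrB_le x y (e := b^-1); rewrite invr_gt0 => /(_ b0).
rewrite invrK; set X := enorm x ^+ 2; set Y := enorm y ^+ 2; set Z := enorm _ ^+ 2 => h.
have Yt : Y <= t.
  by apply: le_trans et; rewrite lerXn2r ?nnegrE ?enorm_ge0 ?ltW.
have -> : X / (2 * (b * t / (1 + b))) = (1 + b^-1) * X / (2 * t).
  by field; rewrite !gt_eqF.
rewrite ler_pdivrMr ?mulr_gt0//.
have -> : ((1 + b) / 2 + (1 + b^-1) * X / (2 * t)) * (2 * t) =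
  (1 + b) * t + (1 + b^-1) * X by field; rewrite !gt_eqF.
apply: (le_trans h); rewrite addrC lerD2r ler_pM2l//.
Qed.

Lemma heat_kernel_near (e : R) x y : 0 < e -> enorm x < 2 * e -> enorm y < 2 * e ->
  (2 * pi * e ^+ 2) `^ (- (n%:R / 2)) * expR (- 8) <= heat_kernel (e ^+ 2) (y - x).
Proof.
move=> e0 xe ye; rewrite /heat_kernel ler_wpM2l ?powR_ge0// ler_expR lerN2.
rewrite ler_pdivrMr ?mulr_gt0 ?exprn_gt0//.
have := enorm_sqrB_le x y (e := 1) ltr01.
have sq z : enorm z < 2 * e -> enorm z ^+ 2 <= 4 * e ^+ 2.
  move=> ze; rewrite (_ : 4 * e ^+ 2 = (2 * e) ^+ 2); last by ring.
  by rewrite lerXn2r ?nnegrE ?enorm_ge0 ?mulr_ge0// ltW.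
have := sq _ xe; have := sq _ ye; rewrite invr1.
set X := enorm x ^+ 2; set Y := enorm y ^+ 2; set Z := enorm _ ^+ 2.
by lra.
Qed.

Lemma measurable_enorm : measurable_fun setT (@enorm R n).
Proof.
rewrite (_ : @enorm R n = fun x => (\sum_(i < n) x ord0 i ^+ 2) `^ 2^-1).
  apply: (measurableT_comp (measurable_powR _)); apply: measurable_sum => i.
  by apply: measurable_funX; exact: measurable_coord.
apply/funext => x; rewrite powR12_sqrt// sumr_ge0// => i _; exact: sqr_ge0.
Qed.

Lemma measurable_eball r : measurable (eball (0 : 'rV[R]_n) r).
Proof.
rewrite (_ : eball _ _ = (@enorm R n) @^-1` `]-oo, r[%classic).
  by rewrite -[X in measurable X]setTI; exact: measurable_enorm.
by apply/seteqP; split=> y; rewrite /eball/= subr0 in_itv.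
Qed.

Definition ball_ind r (y : 'rV[R]_n) : R := \1_(eball 0 r) y.

Lemma ball_indE r y : ball_ind r y = ((enorm y < r)%R : nat)%:R.
Proof.
rewrite /ball_ind indicE; congr (nat_of_bool _)%:R.
by apply/idP/idP; rewrite inE /eball/= subr0.
Qed.

Lemma ball_ind_ge0 r y : 0 <= ball_ind r y.
Proof. by rewrite ball_indE. Qed.

Lemma measurable_ball_ind r : measurable_fun setT (ball_ind r).
Proof. by apply: measurable_indic; exact: measurable_eball. Qed.

Lemma lebesgue_rV_cube r : 0 < r ->
  leb R n [set x | forall i, `]-r, r[%classic (x ord0 i)] = ((2 * r) ^+ n)%:E.
Proof.
move=> r0; rewrite /leb (lebesgue_rV_box (A := fun=> `]-r, r[%classic))//.
rewrite (eq_bigr (fun=> (2 * r)%:E)) => [|i _].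
  by rewrite prodEFin prodr_const card_ord.
rewrite lebesgue_measure_itv/= lte_fin gtrN// opprK.
by congr EFin; ring.
Qed.

Lemma leb_eball_le r : 0 < r -> (leb R n (eball 0 r) <= ((2 * r) ^+ n)%:E)%E.
Proof.
move=> r0; rewrite -lebesgue_rV_cube//; apply: le_measure.
- by rewrite inE; exact: measurable_eball.
- by rewrite inE; exact: (measurable_box (A := fun=> _)).
- move=> x; rewrite /eball/= subr0 => xr i; rewrite in_itv/= -ltr_norml.
  apply: le_lt_trans xr; rewrite -sqrtr_sqr ler_sqrt ?sumr_ge0// => [|j _]; last exact: sqr_ge0.
  by rewrite (bigD1 i)//= lerDl sumr_ge0// => j _; exact: sqr_ge0.
Qed.

(** The cube of half side [r / n.+1] lies inside the ball. *)
Lemma leb_eball_ge r : 0 < r -> (((2 * (r / n.+1%:R)) ^+ n)%:E <= leb R n (eball 0 r))%E.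
Proof.
move=> r0; have r1 : 0 < r / n.+1%:R by rewrite divr_gt0.
rewrite -lebesgue_rV_cube//; apply: le_measure.
- by rewrite inE; exact: (measurable_box (A := fun=> _)).
- by rewrite inE; exact: measurable_eball.
- move=> x /= xr; rewrite /eball/= subr0.
  have : enorm x ^+ 2 < r ^+ 2.
    rewrite enorm_sqr; apply: (@le_lt_trans _ _ (\sum_(i < n) (r / n.+1%:R) ^+ 2)).
      apply: ler_sum => i _; have := xr i; rewrite in_itv/= -ltr_norml => xi.
      by rewrite -real_normK ?num_real// lerXn2r ?nnegrE// ltW.
    rewrite sumr_const card_ord -[ltLHS]mulr_natr expr_div_n -mulrA.
    rewrite -[ltRHS]mulr1 ltr_pM2l ?exprn_gt0// mulrC ltr_pdivrMr ?exprn_gt0//.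
    rewrite mul1r -natrX ltr_nat.
    by apply: (@leq_trans n.+1) => //; rewrite expnS expn1 leq_pmulr.
  by rewrite ltr_pXn2r ?nnegrE ?enorm_ge0 ?(ltW r0).
Qed.

End ball_estimates.

(** * Heat flow of balls *)

Section heat_of_balls.
Context (R : realType) (n : nat).
Implicit Types (x y : 'rV[R]_n) (r s t e : R).

Definition heat_ball t r x : \bar R := heatE t (EFin \o @ball_ind R n r) x.

Let mball r : measurable_fun setT (EFin \o @ball_ind R n r).
Proof. by apply/measurable_EFinP; exact: measurable_ball_ind. Qed.

Let ball0 r y : (0 <= (EFin \o @ball_ind R n r) y)%E.
Proof. by rewrite lee_fin ball_ind_ge0. Qed.

Let mhkball t r x : measurable_fun setT
  (fun y => (heat_kernel t (y - x))%:E * (EFin \o @ball_ind R n r) y)%E.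
Proof.
apply: emeasurable_funM => //; apply/measurable_EFinP; exact: measurable_heat_kernel.
Qed.

Let integral_cst_ball (K r : R) : 0 <= K ->
  (\int[leb R n]_y (K%:E * (EFin \o @ball_ind R n r) y) = K%:E * leb R n (eball 0 r))%E.
Proof.
move=> K0; rewrite ge0_integralZl_EFin//; congr (_ * _)%E.
by rewrite integral_indic// ?setIT//; exact: measurable_eball.
Qed.

Lemma heat_ball_ge0 t r x : (0 <= heat_ball t r x)%E.
Proof. exact: heatE_ge0. Qed.

Lemma measurable_heat_ball t r : measurable_fun setT (heat_ball t r).
Proof.
apply: (@measurable_heatE _ _ _ _ (fun=> t) id (fun=> EFin \o @ball_ind R n r)) => //.
exact: (@measurableT_comp _ _ _ _ _ _ (EFin \o @ball_ind R n r) _ snd).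
Qed.

Lemma heat_ball_semigroup s t r x : 0 < s -> 0 < t ->
  heatE s (heat_ball t r) x = heat_ball (s + t) r x.
Proof. by move=> s0 t0; exact: heatE_semigroup. Qed.

Lemma heat_ball_le_cst (K t r : R) x : 0 < r -> 0 <= K ->
  (forall y, enorm y < r -> heat_kernel t (y - x) <= K) ->
  (heat_ball t r x <= (K * (2 * r) ^+ n)%:E)%E.
Proof.
move=> r0 K0 hK.
apply: (@le_trans _ _ (K%:E * leb R n (eball 0 r))%E).
  rewrite -integral_cst_ball//; apply: ge0_le_integral => //.
  - by move=> y _; rewrite mule_ge0// lee_fin heat_kernel_ge0.
  - by apply: emeasurable_funM.
  - move=> y _ /=; rewrite ball_indE; case: ltP => [yr|_]; last by rewrite !mule0.
    by rewrite !mule1 lee_fin hK.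
by rewrite EFinM lee_wpmul2l// leb_eball_le.
Qed.

Lemma heat_ball_ge_cst (K t r : R) x : 0 < r -> 0 <= K ->
  (forall y, enorm y < r -> K <= heat_kernel t (y - x)) ->
  ((K * (2 * (r / n.+1%:R)) ^+ n)%:E <= heat_ball t r x)%E.
Proof.
move=> r0 K0 hK.
apply: (@le_trans _ _ (K%:E * leb R n (eball 0 r))%E).
  by rewrite EFinM lee_wpmul2l// leb_eball_ge.
rewrite -integral_cst_ball//; apply: ge0_le_integral => //.
- by move=> y _; rewrite mule_ge0.
- by apply: emeasurable_funM.
- move=> y _ /=; rewrite ball_indE; case: ltP => [yr|_]; last by rewrite !mule0.
  by rewrite !mule1 lee_fin hK.
Qed.

Lemma heat_ball_le1 t r x : 0 < t -> (heat_ball t r x <= 1)%E.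
Proof.
move=> t0; rewrite -(heatE_cst x t0 ler01); apply: le_heatE => // y.
by rewrite lee_fin ball_indE lern1 leq_b1.
Qed.

(** The step that makes the upper bound local: what spreads beyond distance
    [a - b] in a short time [s] is an exponentially small part of what spreads
    there in the longer time [t]. *)
Lemma heat_ball_far s t a b r x : 0 < s -> 2 * s <= t -> t <= 3 * s ->
  0 < b -> b < a -> b <= r -> a <= enorm x ->
  (heat_ball s b x <=
   (3 `^ (n%:R / 2) * expR (- ((a - b) ^+ 2 / (4 * s))))%:E * heat_ball t r x)%E.
Proof.
move=> s0 s2 s3 b0 ba br ax; rewrite /heat_ball -heatEZ//.
apply: ge0_le_integral => //.
- by move=> y _; rewrite mule_ge0// lee_fin heat_kernel_ge0.
- apply: emeasurable_funM; first by apply/measurable_EFinP; exact: measurable_heat_kernel.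
  by apply: emeasurable_funM.
- move=> y _ /=; rewrite !ball_indE; case: ltP => [yb|_]; last first.
    by rewrite mule0 !mule_ge0// lee_fin ?heat_kernel_ge0// ?mulr_ge0 ?powR_ge0 ?expR_ge0.
  rewrite (lt_le_trans yb br) !mule1 -EFinM lee_fin [leRHS]mulrC.
  by apply: heat_kernel_far => //; exact: enorm_sqrB_ge.
Qed.

Lemma sqr_powR_half e : 0 < e -> (e ^+ 2) `^ (n%:R / 2) = e ^+ n.
Proof.
move=> e0; rewrite -[e ^+ 2]powR_mulrn ?(ltW e0)// -powRrM mulrCA mulfV// mulr1.
by rewrite powR_mulrn// ltW.
Qed.

Definition near_const : R :=
  ((2 * pi) `^ (- (n%:R / 2)) * expR (- 8) * (4 / n.+1%:R) ^+ n)^-1.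

Lemma near_const_gt0 : 0 < near_const.
Proof.
by rewrite invr_gt0 !mulr_gt0 ?expR_gt0 ?exprn_gt0 ?divr_gt0 ?powR_gt0 ?mulr_gt0 ?pi_gt0.
Qed.

Lemma ball_ind_le_heat_ball e x : 0 < e ->
  ((ball_ind (2 * e) x)%:E <= near_const%:E * heat_ball (e ^+ 2) (2 * e) x)%E.
Proof.
move=> e0; rewrite ball_indE; case: ltP => [xe|_]; last first.
  by rewrite mule_ge0 ?heat_ball_ge0// lee_fin ltW// near_const_gt0.
have e20 : 0 < 2 * e by rewrite mulr_gt0.
have K0 : 0 <= (2 * pi * e ^+ 2) `^ (- (n%:R / 2)) * expR (- 8).
  by rewrite mulr_ge0 ?powR_ge0 ?expR_ge0.
have := heat_ball_ge_cst e20 K0 (fun y => heat_kernel_near e0 xe).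
move=> /(lee_wpmul2l (x := near_const%:E)).
rewrite lee_fin (ltW near_const_gt0) => /(_ isT); apply: le_trans.
rewrite -EFinM lee_fin le_eqVlt; apply/orP; left; apply/eqP.
rewrite powRM ?exprn_ge0 ?mulr_ge0 ?pi_ge0 ?(ltW e0)//.
rewrite [(e ^+ 2) `^ _]powRN sqr_powR_half//.
have -> : 2 * (2 * e / n.+1%:R) = 4 / n.+1%:R * e by ring.
rewrite exprMn /near_const.
have p0 : (2 * pi : R) `^ (- (n%:R / 2)) != 0.
  by rewrite gt_eqF// powR_gt0// mulr_gt0// pi_gt0.
have q0 : (4 / n.+1%:R : R) ^+ n != 0 by rewrite gt_eqF// exprn_gt0// divr_gt0.
have en0 : e ^+ n != 0 by rewrite gt_eqF// exprn_gt0.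
have x0 : expR (- 8 : R) != 0 by rewrite gt_eqF// expR_gt0.
move: p0 q0 en0 x0; move: (_ `^ _) (_ ^+ n) (e ^+ n) (expR _) => P Q F G P0 Q0 F0 G0.
by rewrite mulr1n; field; rewrite P0 Q0 F0 G0.
Qed.

Lemma heat_ball_upper e t tau x : 0 < e -> e ^+ 2 <= t -> t <= tau -> tau <= 3 / 2 * t ->
  (heat_ball tau (2 * e) x <=
   (2 `^ (n%:R / 2) * expR 4 * 4 ^+ n * e ^+ n * heat_kernel (2 * t) x)%:E)%E.
Proof.
move=> e0 et t1 t2; have e20 : 0 < 2 * e by rewrite mulr_gt0.
have K0 : 0 <= 2 `^ (n%:R / 2) * expR 4 * heat_kernel (2 * t) x.
  by rewrite !mulr_ge0 ?powR_ge0 ?expR_ge0.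
apply: le_trans (heat_ball_le_cst e20 K0 (fun y => heat_kernel_upper x e0 et t1 t2)) _.
rewrite lee_fin mulrA (_ : 2 * 2 = 4 :> R); last by ring.
rewrite exprMn le_eqVlt; apply/orP; left; apply/eqP.
by rewrite mulrAC !mulrA.
Qed.

Definition lower_const (b : R) : R :=
  (((1 + b) / b) `^ (n%:R / 2) * expR ((1 + b) / 2))^-1 * (2 / n.+1%:R) ^+ n.

Lemma lower_const_gt0 b : 0 < b -> 0 < lower_const b.
Proof.
move=> b0; rewrite mulr_gt0 ?exprn_gt0 ?divr_gt0// invr_gt0 mulr_gt0 ?expR_gt0//.
by rewrite powR_gt0// divr_gt0// addr_gt0.
Qed.

Lemma heat_ball_lower (b : R) e t x : 0 < b -> 0 < e -> e ^+ 2 <= t ->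
  ((lower_const b * e ^+ n * heat_kernel (b * t / (1 + b)) x)%:E <= heat_ball t e x)%E.
Proof.
move=> b0 e0 et.
pose c := ((1 + b) / b) `^ (n%:R / 2) * expR ((1 + b) / 2).
have c0 : 0 < c by rewrite mulr_gt0 ?expR_gt0// powR_gt0// divr_gt0// addr_gt0.
have K0 : 0 <= c^-1 * heat_kernel (b * t / (1 + b)) x.
  by rewrite mulr_ge0 ?heat_kernel_ge0// invr_ge0 ltW.
have h y : enorm y < e -> c^-1 * heat_kernel (b * t / (1 + b)) x <= heat_kernel t (y - x).
  by move=> ye; rewrite ler_pdivrMl//; exact: (heat_kernel_lower x b0 e0 et ye).
apply: le_trans (heat_ball_ge_cst e0 K0 h).
rewrite lee_fin le_eqVlt; apply/orP; left; apply/eqP.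
have -> : 2 * (e / n.+1%:R) = 2 / n.+1%:R * e by ring.
by rewrite exprMn /lower_const -/c; ring.
Qed.

End heat_of_balls.

(** * Upper bound for solutions started from a ball *)

Section ball_upper.
Context (R : realType) (n : nat).

Lemma powR_exprn (x c : R) (k : nat) : 0 <= x -> (x ^+ k) `^ c = (x `^ c) ^+ k.
Proof.
move=> x0; rewrite -(powR_mulrn k x0) -powRrM mulrC powRrM.
by rewrite powR_mulrn ?powR_ge0.
Qed.

(** The exponential gains at the time scales [2 ^- k] beat the blow-up of the
    solution at these scales. *)
Lemma superexp_decay (q : R) : 0 <= q ->
  exists S, forall k : nat, q ^+ k * expR (- ((9 / 8) ^+ k / 36)) <= S.
Proof.
move=> q0.
have bern (m : nat) : 1 + m%:R / 8 <= (9 / 8 : R) ^+ m.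
  elim: m => [|m IH]; first by rewrite mul0r addr0 expr0.
  rewrite exprS; apply: (@le_trans _ _ (9 / 8 * (1 + m%:R / 8))).
    have m0 : 0 <= m%:R :> R by [].
    by rewrite -natr1; move: m0; move: (m%:R : R) => z z0; lra.
  by rewrite ler_pM2l.
(* With [q <= (9 / 8) ^+ m], it remains to use [expR y >= (y / m) ^+ m]. *)
pose m := (Num.bound (8 * q)).+1.
have qm : q <= (9 / 8 : R) ^+ m.
  apply: le_trans (bern m); rewrite -[leLHS]add0r lerD//.
  rewrite ler_pdivlMr// mulrC; apply: ltW.
  apply: lt_le_trans (archi_boundP _) _; first by rewrite mulr_ge0.
  by rewrite ler_nat leqnSn.
have m0 : 0 < m%:R :> R by rewrite ltr0n.
exists ((36 * m%:R) ^+ m) => k; set y := (9 / 8 : R) ^+ k.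
have y0 : 0 < y by rewrite exprn_gt0.
have ym : (y / (36 * m%:R)) ^+ m <= expR (y / 36).
  have -> : y / 36 = m%:R * (y / (36 * m%:R)) by field; rewrite gt_eqF.
  rewrite expRM_natl lerXn2r ?nnegrE ?expR_ge0 ?divr_ge0 ?mulr_ge0 ?(ltW y0)//.
  by apply: le_trans (expR_ge1Dx _); rewrite lerDr.
rewrite expRN ler_pdivrMr ?expR_gt0//.
apply: (@le_trans _ _ ((36 * m%:R) ^+ m * (y / (36 * m%:R)) ^+ m)).
  rewrite -exprMn mulrC divfK; last by rewrite gt_eqF// mulr_gt0.
  by rewrite /y -exprM mulnC exprM lerXn2r ?nnegrE ?exprn_ge0.
by rewrite ler_pM2l// exprn_gt0// mulr_gt0.
Qed.

Variables (b k0 : R).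
Hypotheses (b_gt0 : 0 < b) (b_le1 : b <= 1) (k0_gt0 : 0 < k0).

Let A := decay_const b k0.
Let c3 : R := 3 `^ (n%:R / 2).
Let p2 (k : nat) : R := (2 `^ b^-1) ^+ k.

Let A_ge0 : 0 <= A. Proof. exact: decay_const_ge0. Qed.
Let c3_ge0 : 0 <= c3. Proof. exact: powR_ge0. Qed.
Let p2_ge0 k : 0 <= p2 k. Proof. by rewrite exprn_ge0 ?powR_ge0. Qed.

Variable S : R.
Hypothesis leS : forall k : nat, (2 `^ b^-1 * 2) ^+ k * expR (- ((9 / 8) ^+ k / 36)) <= S.
Let S1 := c3 * (A + 1) * S.

Let S_ge0 : 0 <= S.
Proof. by apply: le_trans (leS 0); rewrite mulr_ge0 ?expR_ge0. Qed.

Let S1_ge0 : 0 <= S1. Proof. by rewrite !mulr_ge0 ?addr_ge0. Qed.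

Let step_bound (c : R) (k : nat) : 0 <= c <= A + 1 ->
  c * p2 k * (c3 * expR (- ((9 / 8) ^+ k / 36))) <= S1 / 2 ^+ k.
Proof.
move=> /andP[c0 cA]; rewrite ler_pdivlMr ?exprn_gt0//.
have := leS k; rewrite exprMn -/(p2 k) /S1; set E := expR _ => h.
have -> : c * p2 k * (c3 * E) * 2 ^+ k = c3 * c * (p2 k * 2 ^+ k * E) by ring.
by apply: ler_pM => //; [rewrite mulr_ge0|rewrite !mulr_ge0 ?expR_ge0|rewrite ler_wpM2l].
Qed.

Variables (psi : R -> R) (mpsi : measurable_fun setT psi)
  (psi_lb : forall l, 0 <= l -> k0 * l `^ (1 + b) <= psi l).
Variables (e theta : R) (e_gt0 : 0 < e) (theta_ge0 : 0 <= theta).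
Variable v : R -> 'rV[R]_n -> R.
Hypothesis sol : mild_solution psi (fun y => theta * ball_ind e y) v.

Let psi_ge0 l : 0 <= l -> 0 <= psi l.
Proof. by move=> l0; apply: le_trans (psi_lb l0); rewrite mulr_ge0 ?powR_ge0 ?ltW. Qed.

Let f y := theta * @ball_ind R n e y.
Let mf : measurable_fun setT f.
Proof. by apply: measurable_funM => //; exact: measurable_ball_ind. Qed.
Let f_ge0 y : 0 <= f y. Proof. by rewrite mulr_ge0 ?ball_ind_ge0. Qed.
Let f_bounded : exists B, forall y, f y <= B.
Proof.
by exists theta => y; rewrite /f ball_indE ler_piMr// lern1 leq_b1.
Qed.

(** Dyadic times decreasing to 0, with radii decreasing to [e] slowly: since
    [(3 / 4) ^ 2 > 1 / 2], the gap between consecutive radii is large compared to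
    the square root of the time between them. *)
Let sig (k : nat) : R := e ^+ 2 / 2 ^+ k.
Let rho (k : nat) : R := e * (1 + (3 / 4) ^+ k).

Let sig_gt0 k : 0 < sig k. Proof. by rewrite divr_gt0 ?exprn_gt0. Qed.
Let sigS k : sig k = 2 * sig k.+1.
Proof.
rewrite /sig (exprS 2 k); have : (2 : R) ^+ k != 0 by rewrite expf_neq0.
by move: (2 ^+ k) => z z0; field.
Qed.
Let sig_noninc j k : (j <= k)%N -> sig k <= sig j.
Proof.
move=> jk; rewrite ler_pM2l ?exprn_gt0// lef_pV2 ?posrE ?exprn_gt0//.
by rewrite ler_weXn2l// ler1n.
Qed.
Let e_lt_rho k : e < rho k.
Proof. by rewrite /rho ltr_pMr// ltrDl exprn_gt0. Qed.
Let rho_le k : rho k <= 2 * e.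
Proof.
rewrite /rho mulrC ler_pM2r// (_ : 2 = 1 + 1 :> R)// lerD2l.
by rewrite exprn_ile1//; lra.
Qed.
Let rhoB k : rho k - rho k.+1 = e * (3 / 4) ^+ k / 4.
Proof. by rewrite /rho exprS; move: ((3 / 4) ^+ k) => z; field. Qed.

Let sig_powR k : sig k `^ (- b^-1) = e `^ (- (2 / b)) * p2 k.
Proof.
rewrite /sig powRM ?invr_ge0 ?exprn_ge0 ?(ltW e_gt0)//; congr (_ * _).
  by rewrite -[e ^+ 2]powR_mulrn ?(ltW e_gt0)// -powRrM mulrN.
rewrite -powR_inv1 ?exprn_ge0// -powRrM mulrN mulNr mul1r opprK.
by rewrite powR_exprn.
Qed.

Let w := e `^ (- (2 / b)).
Let w_ge0 : 0 <= w. Proof. exact: powR_ge0. Qed.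

Let wA_ge0 k : 0 <= w * A * p2 k.
Proof. by apply: mulr_ge0 => //; exact: mulr_ge0. Qed.

Let wS_ge0 k : 0 <= w * S1 / 2 ^+ k.
Proof. by apply: divr_ge0; [exact: mulr_ge0|exact: exprn_ge0]. Qed.

Variable N : nat.
Hypotheses (N_gt0 : (0 < N)%N) (theta_le : theta <= w * p2 N).

(** Inside the ball of radius [rho k] the solution is only known to decay in time;
    outside, what has escaped at earlier scales is controlled by the heat flow of
    the ball of radius [2 * e]. The extra time [sig N] is for the first step,
    where [heat_ball_far] needs twice the length of the step. *)
Let envelope (k : nat) (x : 'rV[R]_n) : \bar R := ((w * A * p2 k * ball_ind (rho k) x)%:E +
  (w * S1 / 2 ^+ k)%:E * heat_ball (sig k + sig N) (2 * e) x)%E.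

Let hb0 t r x : (0 <= @heat_ball R n t r x)%E. Proof. exact: heat_ball_ge0. Qed.

Let inside k x : enorm x < rho k -> ((v (sig k) x)%:E <= envelope k x)%E.
Proof.
move=> xr; rewrite /envelope ball_indE xr mulr1 -[leLHS]adde0.
apply: leeD; last by rewrite mule_ge0// lee_fin.
rewrite lee_fin (_ : w * A * p2 k = A * sig k `^ (- b^-1)); last first.
  by rewrite sig_powR /w; ring.
exact: (mild_decay mpsi psi_ge0 mf f_ge0 f_bounded sol b_gt0 b_le1 k0_gt0 psi_lb).
Qed.

(** The first step starts at time 0, where the solution is at most [theta]; the
    choice of [N] makes [theta] no larger than the natural size at time [sig N]. *)
Let envelope_top x : ((v (sig N) x)%:E <= envelope N x)%E.
Proof.
have [xr|xr] := ltP (enorm x) (rho N); first exact: inside.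
apply: (@le_trans _ _ ((w * S1 / 2 ^+ N)%:E * heat_ball (sig N + sig N) (2 * e) x)%E); last first.
  by rewrite /envelope leeDr// lee_fin; apply: mulr_ge0 => //; exact: ball_ind_ge0.
apply: le_trans (mild_le_heat psi_ge0 sol x (sig_gt0 N)) _.
rewrite (_ : EFin \o _ = fun y => theta%:E * (EFin \o @ball_ind R n e) y)%E; last first.
  by apply/funext => y; rewrite /= EFinM.
rewrite heatEZ//; last 2 first.
- by apply/measurable_EFinP; exact: measurable_ball_ind.
- by move=> y; rewrite lee_fin ball_ind_ge0.
have s2 : 2 * sig N <= sig N + sig N by rewrite mulr_natl mulr2n.
have s3 : sig N + sig N <= 3 * sig N.
  by have := sig_gt0 N; move: (sig N) => z z0; lra.
have e2 : e <= 2 * e by rewrite ler_pMl// ler1n.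
have := heat_ball_far (sig_gt0 N) s2 s3 e_gt0 (e_lt_rho N) e2 xr.
move=> /(lee_wpmul2l (x := theta%:E)); rewrite lee_fin => /(_ theta_ge0) h.
apply: (le_trans h); rewrite muleA -EFinM; apply: lee_wpmul2r => //.
rewrite lee_fin.
have -> : rho N - e = e * (3 / 4) ^+ N by rewrite /rho; ring.
have -> : (e * (3 / 4) ^+ N) ^+ 2 / (4 * sig N) = (9 / 8) ^+ N / 4.
  rewrite /sig (_ : (9 / 8) ^+ N = ((3 / 4) ^+ N) ^+ 2 * 2 ^+ N :> R); last first.
    by rewrite -exprM mulnC exprM -exprMn; congr (_ ^+ _); field.
  have : (2 : R) ^+ N != 0 by rewrite expf_neq0.
  have : e != 0 by rewrite gt_eqF.
  by move: ((3 / 4) ^+ N) (2 ^+ N) => y z e0 z0; field; rewrite e0 z0.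
apply: (@le_trans _ _ (w * p2 N * (c3 * expR (- ((9 / 8) ^+ N / 36))))).
  apply: ler_pM => //; rewrite ler_wpM2l// ler_expR lerN2 ler_wpM2l ?exprn_ge0//.
  by rewrite lef_pV2 ?posrE// ler_nat.
have := @step_bound 1 N; rewrite ler01 lerDr A_ge0 => /(_ isT) /(ler_wpM2l w_ge0).
by rewrite mul1r !mulrA.
Qed.

(** Over one dyadic step the inside part of the envelope leaks to the outside, at
    an exponentially small cost that [S1 / 2 ^+ k.+1] absorbs; the outside part is
    carried by the semigroup. The two costs add up to [S1 / 2 ^+ k]. *)
Let envelope_step k : (k < N)%N -> (forall x, ((v (sig k.+1) x)%:E <= envelope k.+1 x)%E) ->
  forall x, ((v (sig k) x)%:E <= envelope k x)%E.
Proof.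
move=> kN IH x.
have [xr|xr] := ltP (enorm x) (rho k); first exact: inside.
apply: (@le_trans _ _ ((w * S1 / 2 ^+ k)%:E * heat_ball (sig k + sig N) (2 * e) x)%E); last first.
  by rewrite /envelope leeDr// lee_fin; apply: mulr_ge0 => //; exact: ball_ind_ge0.
have sk : 0 < sig k.+1 < sig k by rewrite sig_gt0 (sigS k) ltr_pMl// ltr1n.
apply: le_trans (mild_le_heat_mild mpsi psi_ge0 mf f_ge0 sol f_bounded x sk) _.
have -> : sig k - sig k.+1 = sig k.+1 by rewrite (sigS k); ring.
have m1 : measurable_fun setT (fun y => (w * A * p2 k.+1)%:E * (EFin \o @ball_ind R n (rho k.+1)) y)%E.
  by apply: emeasurable_funM => //; apply/measurable_EFinP; exact: measurable_ball_ind.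
have m2 : measurable_fun setT (fun y : 'rV[R]_n => (w * S1 / 2 ^+ k.+1)%:E *
    heat_ball (sig k.+1 + sig N) (2 * e) y)%E.
  by apply: emeasurable_funM => //; exact: measurable_heat_ball.
have c10 := wA_ge0 k.+1; have c20 := wS_ge0 k.+1.
have envE : envelope k.+1 = (fun y =>
    (w * A * p2 k.+1)%:E * (EFin \o @ball_ind R n (rho k.+1)) y +
    (w * S1 / 2 ^+ k.+1)%:E * heat_ball (sig k.+1 + sig N) (2 * e) y)%E.
  by apply/funext => y; rewrite /envelope EFinM.
apply: (@le_trans _ _ (heatE (sig k.+1) (envelope k.+1) x)).
  apply: le_heatE => //.
  - by apply/measurable_EFinP; apply: (measurable_mild_slice sol); exact: ltW.
  - by rewrite envE; apply: emeasurable_funD.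
  - by move=> y; rewrite lee_fin (mild_ge0 sol)// ltW.
rewrite envE heatED//; last 2 first.
- by move=> y; rewrite mule_ge0// lee_fin ball_ind_ge0.
- by move=> y; rewrite mule_ge0.
rewrite heatEZ//; last 2 first.
- by apply/measurable_EFinP; exact: measurable_ball_ind.
- by move=> y; rewrite lee_fin ball_ind_ge0.
rewrite heatEZ//; last exact: measurable_heat_ball.
have sN := sig_gt0 N.
rewrite heat_ball_semigroup ?addr_gt0// addrA.
have -> : sig k.+1 + sig k.+1 = sig k by rewrite (sigS k); ring.
have -> : w * S1 / 2 ^+ k = w * S1 / 2 ^+ k.+1 + w * S1 / 2 ^+ k.+1.
  rewrite (exprS 2 k); have : (2 : R) ^+ k != 0 by rewrite expf_neq0.
  by move: (2 ^+ k) => z z0; field.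
rewrite EFinD ge0_muleDl ?lee_fin//; apply: leeD => //.
have t2 : 2 * sig k.+1 <= sig k + sig N by rewrite (sigS k) lerDl ltW.
have t3 : sig k + sig N <= 3 * sig k.+1.
  rewrite (sigS k) (_ : 3 * sig k.+1 = 2 * sig k.+1 + sig k.+1); last by ring.
  by rewrite lerD2l sig_noninc.
have rr : rho k.+1 < rho k.
  by rewrite -subr_gt0 rhoB divr_gt0// mulr_gt0// exprn_gt0.
have r0 : 0 < rho k.+1 by exact: lt_trans (e_lt_rho _).
have := heat_ball_far (sig_gt0 k.+1) t2 t3 r0 rr (rho_le _) xr.
move=> /(lee_wpmul2l (x := (w * A * p2 k.+1)%:E)); rewrite lee_fin => /(_ c10) h.
apply: (le_trans h); rewrite muleA -EFinM; apply: lee_wpmul2r => //.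
rewrite lee_fin rhoB.
have -> : (e * (3 / 4) ^+ k / 4) ^+ 2 / (4 * sig k.+1) = (9 / 8) ^+ k.+1 / 36.
  rewrite /sig (exprS 2 k) (exprS _ k).
  rewrite (_ : (9 / 8) ^+ k = ((3 / 4) ^+ k) ^+ 2 * 2 ^+ k :> R); last first.
    by rewrite -exprM mulnC exprM -exprMn; congr (_ ^+ _); field.
  have : (2 : R) ^+ k != 0 by rewrite expf_neq0.
  have : e != 0 by rewrite gt_eqF.
  by move: ((3 / 4) ^+ k) (2 ^+ k) => y z e0 z0; field; rewrite e0 z0.
have := @step_bound A k.+1; rewrite A_ge0 lerDl ler01 => /(_ isT) /(ler_wpM2l w_ge0).
by rewrite !mulrA.
Qed.

Let envelope_all j : (j <= N)%N ->
  forall x, ((v (sig (N - j)) x)%:E <= envelope (N - j) x)%E.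
Proof.
elim: j => [|j IH] jN; first by rewrite subn0; exact: envelope_top.
apply: envelope_step; first by rewrite ltn_subrL.
by move=> x; rewrite (subnSK jN); exact: IH (ltnW jN) x.
Qed.

Definition ball_upper_const : R :=
  (A * @near_const R n + S1) * (2 `^ (n%:R / 2) * expR 4 * 4 ^+ n).

(** At scale 0 the envelope is dominated by heat flows of the ball of radius
    [2 * e], and the semigroup carries these from time [e ^+ 2] to time [t]. *)
Lemma mild_ball_upper_at t x : e ^+ 2 <= t ->
  v t x <= ball_upper_const * (e ^+ n * w) * heat_kernel (2 * t) x.
Proof.
move=> et; have t0 : 0 < t by apply: lt_le_trans et; rewrite exprn_gt0.
have nc0 := ltW (@near_const_gt0 R n).
pose G s y := ((w * (A * @near_const R n))%:E * heat_ball s (2 * e) y +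
  (w * S1)%:E * @heat_ball R n (s + sig N) (2 * e) y)%E.
have c10 : 0 <= w * (A * @near_const R n) by rewrite !mulr_ge0.
have c20 : 0 <= w * S1 by rewrite mulr_ge0.
have G1 y : ((v (e ^+ 2)%R y)%:E <= G (e ^+ 2)%R y)%E.
  have := @envelope_all N (leqnn N) y.
  rewrite subnn /envelope {1 2}/sig /rho !expr0 !divr1 (_ : e * (1 + 1) = 2 * e); last by ring.
  move=> h; apply: (le_trans h); apply: leeD => //.
  rewrite /p2 expr0 mulr1 EFinM.
  rewrite (_ : (w * (A * _))%:E = (w * A)%:E * (@near_const R n)%:E)%E; last first.
    by rewrite -EFinM mulrA.
  rewrite -muleA.
  by rewrite lee_wpmul2l ?lee_fin ?mulr_ge0// ball_ind_le_heat_ball.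
have mG s : measurable_fun setT (G s).
  by apply: emeasurable_funD; apply: emeasurable_funM => //; exact: measurable_heat_ball.
have Gt : ((v t x)%:E <= G t x)%E.
  move: et; rewrite le_eqVlt => /predU1P[<-//|et].
  have st : 0 < e ^+ 2 < t by rewrite et exprn_gt0.
  apply: le_trans (mild_le_heat_mild mpsi psi_ge0 mf f_ge0 sol f_bounded x st) _.
  have ts : 0 < t - e ^+ 2 by rewrite subr_gt0.
  have e20 : 0 < e ^+ 2 by rewrite exprn_gt0.
  apply: (@le_trans _ _ (heatE (t - e ^+ 2) (G (e ^+ 2)) x)).
    apply: le_heatE => //.
    - by apply/measurable_EFinP; apply: (measurable_mild_slice sol); exact: ltW.
    - by move=> y; rewrite lee_fin (mild_ge0 sol)// ltW.
  rewrite /G heatED//; last 4 first.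
  - by apply: emeasurable_funM => //; exact: measurable_heat_ball.
  - by apply: emeasurable_funM => //; exact: measurable_heat_ball.
  - by move=> y; rewrite mule_ge0.
  - by move=> y; rewrite mule_ge0.
  rewrite (heatEZ _ _ c10 (measurable_heat_ball _ _) (hb0 _ _)).
  rewrite (heatEZ _ _ c20 (measurable_heat_ball _ _) (hb0 _ _)).
  rewrite (heat_ball_semigroup _ _ ts e20) (heat_ball_semigroup _ _ ts (addr_gt0 e20 (sig_gt0 N))).
  by rewrite addrA subrK.
have sN : sig N <= t / 2.
  apply: (le_trans (sig_noninc N_gt0)); rewrite /sig expr1.
  by rewrite ler_wpM2r// invr_ge0.
rewrite -lee_fin; apply: (le_trans Gt); rewrite /G.
have tt : t <= t + sig N by rewrite lerDl ltW.
have t32 : t + sig N <= 3 / 2 * t.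
  by rewrite (_ : 3 / 2 * t = t + t / 2) ?lerD2l//; field.
have t33 : t <= 3 / 2 * t by apply: le_trans t32.
have h1 := lee_wpmul2l (x := (w * (A * @near_const R n))%:E) _
  (heat_ball_upper x e_gt0 et (lexx t) t33).
have h2 := lee_wpmul2l (x := (w * S1)%:E) _ (heat_ball_upper x e_gt0 et tt t32).
apply: (le_trans (leeD (h1 _) (h2 _))); rewrite ?lee_fin//.
rewrite le_eqVlt; apply/orP; left; apply/eqP.
by rewrite /ball_upper_const; ring.
Qed.

End ball_upper.

Section ball_upper_existence.
Context (R : realType) (n : nat).

(** The constant does not depend on the initial mass [theta], nor on [psi] beyond
    the lower bound [k0 * l `^ (1 + b)]; so it serves the stable and all the
    truncated mechanisms, and survives the limit of infinite [theta]. *)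
Theorem mild_ball_upper (b k0 : R) : 0 < b -> b <= 1 -> 0 < k0 ->
  exists2 C : R, 0 < C & forall (psi : R -> R), measurable_fun setT psi ->
    (forall l, 0 <= l -> k0 * l `^ (1 + b) <= psi l) ->
    forall (e theta : R) (v : R -> 'rV[R]_n -> R), 0 < e -> 0 <= theta ->
    mild_solution psi (fun y => theta * ball_ind e y) v ->
    forall t x, e ^+ 2 <= t ->
    v t x <= C * e `^ (n%:R - 2 / b) * heat_kernel (2 * t) x.
Proof.
move=> b0 b1 k00.
have q0 : 0 <= 2 `^ b^-1 * 2 :> R by rewrite mulr_ge0 ?powR_ge0.
have [S leS] := superexp_decay q0.
exists (`|ball_upper_const n b k0 S| + 1); first by rewrite ltr_wpDl.
move=> psi mpsi psi_lb e theta v e0 th0 sol t x et.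
have w0 : 0 < e `^ (- (2 / b)) by rewrite powR_gt0.
(* Any [N] with [theta <= e `^ (- (2 / b)) * 2 `^ (N / b)] will do; it must be
   positive for the extra time [e ^+ 2 / 2 ^+ N] to stay below [t / 2]. *)
pose N := (Num.bound (theta / e `^ (- (2 / b)))).+1.
have thN : theta <= e `^ (- (2 / b)) * (2 `^ b^-1) ^+ N.
  rewrite mulrC -ler_pdivrMr//; apply: (@le_trans _ _ (N%:R)).
    apply: ltW; apply: lt_le_trans (archi_boundP _) _; first by rewrite divr_ge0// ltW.
    by rewrite ler_nat leqnSn.
  apply: (@le_trans _ _ (2 ^+ N)).
    by rewrite -natrX ler_nat ltnW// ltn_expl.
  rewrite lerXn2r ?nnegrE ?powR_ge0// le1r_powR ?ler1n//.
  by rewrite invf_ge1.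
apply: (le_trans (mild_ball_upper_at b0 b1 k00 leS mpsi psi_lb e0 th0 sol (ltn0Sn _) thN x et)).
apply: ler_wpM2r; first exact: heat_kernel_ge0.
have -> : e ^+ n * e `^ (- (2 / b)) = e `^ (n%:R - 2 / b).
  rewrite powRD; last by rewrite (gt_eqF e0) implybT.
  by rewrite powR_mulrn// ltW.
apply: ler_wpM2r; first exact: powR_ge0.
by apply: (le_trans (ler_norm _)); rewrite lerDl.
Qed.

End ball_upper_existence.

(** * Integrals of powers *)

Section power_integrals.
Context (R : realType).
Implicit Types (a b p K : R).

Lemma continuous_powR p x : 0 < x -> {for x, continuous (@powR R ^~ p)}.
Proof.
move=> x0; apply: differentiable_continuous; apply/derivable1_diffP.
by apply: derivable_powR; rewrite in_itv/= andbT.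
Qed.

(** The bounds over unbounded intervals and at 0 follow from this case by monotone
    convergence. *)
Lemma integral_powR_itv p a b : p + 1 != 0 -> 0 < a -> a < b ->
  (\int[lebesgue_measure]_(x in `[a, b]) (x `^ p)%:E =
   ((b `^ (p + 1) - a `^ (p + 1)) / (p + 1))%:E)%E.
Proof.
move=> p0 a0 ab; pose F x := x `^ (p + 1) / (p + 1).
have b0 := lt_trans a0 ab.
have cF x : 0 < x -> {for x, continuous F}.
  by move=> x0; apply: cvgM; [exact: continuous_powR|exact: cvg_cst].
rewrite (@continuous_FTC2 _ _ F)//.
- by rewrite -EFinB -mulrBl.
- apply: continuous_in_subspaceT => x; rewrite inE/= in_itv/= => /andP[ax _].
  by apply: continuous_powR; exact: lt_le_trans ax.
- split.
  + move=> x; rewrite in_itv/= => /andP[ax _].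
    apply: derivableM => //; apply: derivable_powR.
    by rewrite in_itv/= andbT (lt_trans a0).
  + exact: cvg_at_right_filter (cF _ a0).
  + exact: cvg_at_left_filter (cF _ b0).
- move=> x; rewrite in_itv/= => /andP[ax _]; have x0 := lt_trans a0 ax.
  rewrite derive1E /F deriveM//=; last first.
    by apply: derivable_powR; rewrite in_itv/= andbT.
  rewrite derive_cst scaler0 add0r.
  have -> := @derive_val _ _ _ _ _ _ _ (is_derive1_powR (p + 1) x0).
  by rewrite addrK /GRing.scale/= mulrA mulVf// mul1r.
Qed.

Lemma ge0_integral_bigcup_le d (T : measurableType d)
    (mu : {measure set T -> \bar R}) (F : (set T)^nat) (f : T -> \bar R) (M : \bar R) :
  nondecreasing_seq F -> (forall i, measurable (F i)) -> measurable_fun setT f ->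
  (forall x, 0 <= f x)%E -> (forall i, \int[mu]_(x in F i) f x <= M)%E ->
  (\int[mu]_(x in \bigcup_i F i) f x <= M)%E.
Proof.
move=> ndF mF mf f0 FM.
have h := @ge0_nondecreasing_set_cvg_integral _ _ _ F f mu ndF mF
  (fun i => measurable_funS measurableT (@subsetT _ _) mf) (fun i x _ => f0 x).
rewrite -(cvg_lim _ h)//; apply: lime_le; first by apply/cvg_ex; eexists; exact: h.
by apply: nearW.
Qed.

Let mpowR p : measurable_fun setT (fun x : R => (x `^ p)%:E).
Proof. by apply/measurable_EFinP; exact: measurable_powR. Qed.

Lemma integral_powR_tail_le a p : 0 < a -> 1 < p ->
  (\int[lebesgue_measure]_(x in `[a, +oo[) (x `^ (- p))%:E <= (a `^ (1 - p) / (p - 1))%:E)%E.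
Proof.
move=> a0 p1.
rewrite (_ : `[a, +oo[%classic = \bigcup_(i : nat) `[a, a + i.+1%:R]%classic); last first.
  apply/seteqP; split=> x /=.
    rewrite in_itv/= andbT => ax; exists (Num.bound (x - a)) => //=.
    rewrite in_itv/= ax/= -lerBlDl; apply: ltW.
    have := archi_boundP (x := x - a); rewrite subr_ge0 => /(_ ax) h.
    by apply: (lt_le_trans h); rewrite ler_nat.
  by move=> [i _ /=]; rewrite !in_itv/= => /andP[->].
apply: ge0_integral_bigcup_le => //.
- move=> i j ij; rewrite subsetEset => x /=; rewrite !in_itv/= => /andP[-> h] /=.
  by apply: (le_trans h); rewrite lerD2l ler_nat.
- exact: mpowR.
- by move=> x; rewrite lee_fin powR_ge0.
- move=> i; have ai : a < a + i.+1%:R by rewrite ltrDl.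
  rewrite integral_powR_itv//; last by rewrite addrC subr_eq0 lt_eqF.
  have e : (1 - p)^-1 = - (p - 1)^-1 by rewrite -invrN opprB.
  rewrite (addrC (- p)) lee_fin e mulrN -mulNr ler_wpM2r//.
    by rewrite invr_ge0 subr_ge0 ltW.
  by rewrite opprB gerBl powR_ge0.
Qed.

Lemma integral_powR_head_le K p : 0 < K -> p < 1 ->
  (\int[lebesgue_measure]_(x in `]0%R, K]) (x `^ (- p))%:E <= (K `^ (1 - p) / (1 - p))%:E)%E.
Proof.
move=> K0 p1.
have Ki (i : nat) : 0 < K / i.+2%:R < K.
  by rewrite divr_gt0//= ltr_pdivrMr// ltr_pMr// ltr1n.
rewrite (_ : `]0%R, K]%classic = \bigcup_(i : nat) `[K / i.+2%:R, K]%classic); last first.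
  apply/seteqP; split=> x /=.
    rewrite in_itv/= => /andP[x0 xK]; exists (Num.bound (K / x)) => //=.
    rewrite in_itv/= xK andbT ler_pdivrMr// -ler_pdivrMl// mulrC; apply: ltW.
    have := archi_boundP (x := K / x); rewrite divr_ge0 ?ltW// => /(_ isT) h.
    by apply: (lt_le_trans h); rewrite ler_nat -addn2 leq_addr.
  move=> [i _ /=]; rewrite !in_itv/= => /andP[ix ->]; rewrite andbT.
  by apply: lt_le_trans ix; case/andP: (Ki i).
apply: ge0_integral_bigcup_le => //.
- move=> i j ij; rewrite subsetEset => x /=; rewrite !in_itv/= => /andP[h ->].
  rewrite andbT; apply: le_trans h; rewrite ler_wpM2l ?(ltW K0)//.
  by rewrite lef_pV2 ?posrE// ler_nat.
- exact: mpowR.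
- by move=> x; rewrite lee_fin powR_ge0.
- move=> i; case/andP: (Ki i) => i0 iK.
  have p10 : 0 < 1 - p by rewrite subr_gt0.
  rewrite integral_powR_itv//; last by rewrite addrC gt_eqF.
  rewrite (addrC (- p)) lee_fin ler_wpM2r//; first by rewrite invr_ge0 ltW.
  by rewrite gerBl powR_ge0.
Qed.

End power_integrals.

(** * Lower bound for solutions started from a ball *)

Section ball_lower.
Context (R : realType) (n : nat).
Variable b : R.
Hypotheses (b_gt0 : 0 < b) (n_gt : 2 / b < n%:R).

Let p := n%:R * b / 2.
Let p_gt1 : 1 < p.
Proof. by rewrite /p ltr_pdivlMr// mul1r -ltr_pdivrMr//. Qed.
Let c1 : R := ((2 * pi) `^ (- (n%:R / 2)) * 2 ^+ n) `^ b.
Let c2 : R := 1 + c1 / (p - 1).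
Let c1_ge0 : 0 <= c1. Proof. exact: powR_ge0. Qed.
Let c2_gt0 : 0 < c2.
Proof. by rewrite ltr_pwDl// divr_ge0// subr_ge0 ltW. Qed.
(** Small enough for at most half of the mass to be lost to absorption. *)
Definition small_mass : R := (2 * c2)^-1 `^ b^-1.
Let th0 := small_mass.
Lemma small_mass_gt0 : 0 < small_mass.
Proof. by rewrite powR_gt0// invr_gt0 mulr_gt0. Qed.
Let th0_gt0 := small_mass_gt0.

Variables (e : R) (e_gt0 : 0 < e).
Let theta := th0 * e `^ (- (2 / b)).
Let theta_gt0 : 0 < theta. Proof. by apply: mulr_gt0 => //; exact: powR_gt0. Qed.
Let theta_b : theta `^ b * e ^+ 2 * c2 = 2^-1.
Proof.
rewrite /theta /th0 /small_mass powRM ?powR_ge0// -!powRrM mulVf ?gt_eqF// mulNr divfK ?gt_eqF//.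
rewrite powRr1 ?invr_ge0 ?mulr_ge0 ?(ltW c2_gt0)//.
rewrite powRN powR_mulrn ?(ltW e_gt0)//.
have h1 := c2_gt0; have h2 : e ^+ 2 != 0 by rewrite expf_neq0// gt_eqF.
by move: (e ^+ 2) h2 => E E0; field; rewrite E0 gt_eqF.
Qed.

Variable v : R -> 'rV[R]_n -> R.
Hypothesis sol : mild_solution (stable_mechanism b) (fun y => theta * ball_ind e y) v.

Let f y := theta * @ball_ind R n e y.
Let psi_ge0 l : 0 <= l -> 0 <= stable_mechanism b l.
Proof. by move=> _; exact: powR_ge0. Qed.
Let mpsi : measurable_fun setT (stable_mechanism b).
Proof. exact: measurable_powR. Qed.
Let mf : measurable_fun setT f.
Proof. by apply: measurable_funM => //; exact: measurable_ball_ind. Qed.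
Let f_ge0 y : 0 <= f y. Proof. by rewrite mulr_ge0 ?ball_ind_ge0// ltW. Qed.

Let heat_f t x : heatE t (EFin \o f) x = (theta%:E * heat_ball t e x)%E.
Proof.
rewrite -heatEZ ?(ltW theta_gt0)//.
- by apply/measurable_EFinP; exact: measurable_ball_ind.
- by move=> y; rewrite lee_fin ball_ind_ge0.
Qed.

(** A uniform bound on [v s `^ b]. It is integrable at infinity because
    [n * b / 2 > 1]: this is where the dimension enters. *)
Let rate (s : R) : R := theta `^ b *
  (if s < e ^+ 2 then 1 else c1 * (e ^+ 2) `^ p * s `^ (- p)).

Let rate_ge0 s : 0 <= rate s.
Proof. by rewrite mulr_ge0 ?powR_ge0//; case: ifPn => _//; rewrite !mulr_ge0 ?powR_ge0. Qed.

Let mild_powR_le s y : 0 < s -> v s y `^ b <= rate s.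
Proof.
move=> s0; have v0 : 0 <= v s y by rewrite (mild_ge0 sol)// ltW.
have := mild_le_heat psi_ge0 sol y s0; rewrite heat_f => hv.
rewrite /rate; case: ifPn => [_|].
  rewrite mulr1 ge0_ler_powR ?nnegrE ?(ltW b_gt0) ?(ltW theta_gt0)//.
  rewrite -lee_fin (le_trans hv)// -[leRHS]mule1 lee_wpmul2l ?heat_ball_le1//.
  by rewrite lee_fin ltW.
rewrite -leNgt => es.
have K0 : 0 <= (2 * pi * s) `^ (- (n%:R / 2)) by exact: powR_ge0.
have := @heat_ball_le_cst _ n _ s e y e_gt0 K0
  (fun z _ => heat_kernel_le_peak (z - y) (ltW s0)).
move=> /(lee_wpmul2l (x := theta%:E)); rewrite lee_fin (ltW theta_gt0) => /(_ isT) h.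
have := le_trans hv h; rewrite lee_fin => {hv} hv {h}.
have pi0 : 0 <= 2 * pi :> R by rewrite mulr_ge0 ?pi_ge0.
have -> : theta `^ b * (c1 * (e ^+ 2) `^ p * s `^ (- p)) =
    (theta * ((2 * pi * s) `^ (- (n%:R / 2)) * (2 * e) ^+ n)) `^ b.
  rewrite (powRM _ (ltW theta_gt0)); last by rewrite mulr_ge0 ?exprn_ge0 ?mulr_ge0// ltW.
  congr (_ * _); rewrite (powRM _ pi0 (ltW s0)) exprMn.
  have -> : e ^+ n = (e ^+ 2) `^ (n%:R / 2) by rewrite sqr_powR_half.
  set P := (2 * pi) `^ _; set Q := s `^ (- (n%:R / 2)); set E := (e ^+ 2) `^ (n%:R / 2).
  rewrite (_ : P * Q * (2 ^+ n * E) = (P * 2 ^+ n) * (E * Q)); last by ring.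
  rewrite powRM ?mulr_ge0 ?powR_ge0 ?exprn_ge0//.
  rewrite -/c1 -mulrA; congr (_ * _); rewrite powRM ?powR_ge0//.
  by rewrite /E /Q -!powRrM /p mulNr mulrAC.
rewrite ge0_ler_powR ?nnegrE ?(ltW b_gt0)//.
apply: mulr_ge0; first exact: ltW.
apply: mulr_ge0; first exact: powR_ge0.
by rewrite exprn_ge0// mulr_ge0// ltW.
Qed.

Let measurable_rate : measurable_fun setT rate.
Proof.
apply: measurable_funM => //; apply: measurable_fun_ifT => //.
  by apply: measurable_fun_ltr.
by apply: measurable_funM => //; exact: measurable_powR.
Qed.

Let integral_rate :
  (\int[lebesgue_measure]_(s in `]0%R, +oo[) (rate s)%:E <= 2^-1%:E)%E.
Proof.
have e20 : 0 < e ^+ 2 by rewrite exprn_gt0.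
rewrite (_ : `]0%R, +oo[%classic = `]0%R, e ^+ 2[ `|` `[e ^+ 2, +oo[); last first.
  by rewrite -itv_bndbnd_setU// bnd_simp.
rewrite ge0_integral_setU//=; last 3 first.
- by apply/measurable_EFinP; exact: measurable_funTS.
- by move=> s _; rewrite lee_fin.
- apply/disj_setPLR => s /=; rewrite !in_itv/= andbT => /andP[_ qs].
  by rewrite leNgt qs.
have -> : (2^-1%:E = (theta `^ b * e ^+ 2)%:E + (theta `^ b * (e ^+ 2 * (c1 / (p - 1))))%:E)%E.
  by rewrite -EFinD; congr EFin; rewrite -theta_b /c2; ring.
apply: leeD.
  rewrite (@eq_integral _ _ _ _ _ (fun=> (theta `^ b)%:E)); last first.
    by move=> s; rewrite inE/= in_itv/= /rate => /andP[_ ->]; rewrite mulr1.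
  rewrite integral_cst//= lebesgue_measure_itv/= lte_fin e20.
  by rewrite oppr0 adde0 -EFinM.
apply: (@le_trans _ _ (\int[lebesgue_measure]_(s in `[(e ^+ 2)%R, +oo[)
    ((theta `^ b * (c1 * (e ^+ 2) `^ p))%R%:E * (s `^ (- p))%:E))%E).
  rewrite le_eqVlt; apply/orP; left; apply/eqP; apply: eq_integral => s.
  by rewrite inE/= in_itv/= andbT /rate leNgt => /negbTE ->; rewrite -EFinM !mulrA.
have cc0 : 0 <= theta `^ b * (c1 * (e ^+ 2) `^ p) by rewrite !mulr_ge0 ?powR_ge0.
rewrite ge0_integralZl//; last 2 first.
- by apply/measurable_EFinP; apply: measurable_funTS; exact: measurable_powR.
- by move=> s _; rewrite lee_fin powR_ge0.
have := integral_powR_tail_le e20 p_gt1.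
move=> /(lee_wpmul2l (x := (theta `^ b * (c1 * (e ^+ 2) `^ p))%:E)).
rewrite lee_fin => /(_ cc0) h; apply: (le_trans h); rewrite -EFinM lee_fin.
rewrite le_eqVlt; apply/orP; left; apply/eqP.
have hE : (e ^+ 2) `^ p * (e ^+ 2) `^ (1 - p) = e ^+ 2.
  rewrite -powRD; last by rewrite (gt_eqF e20) implybT.
  by rewrite subrKC powRr1// ltW.
by rewrite -[in RHS]hE; ring.
Qed.

(** One factor [v s] is bounded by the heat flow of [f], which the semigroup
    carries to time [t]; the other factor [v s `^ b] is bounded uniformly. *)
Let absorption_le t x s : 0 < s < t ->
  (absorption (stable_mechanism b) v t x s <= (rate s)%:E * heatE t (EFin \o f) x)%E.
Proof.
move=> /andP[s0 st].
have ts : 0 < t - s by rewrite subr_gt0.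
have mEf : measurable_fun setT (EFin \o f) by exact/measurable_EFinP.
have Ef0 y : (0 <= (EFin \o f) y)%E by rewrite lee_fin.
have -> : heatE t (EFin \o f) x = heatE (t - s) (heatE s (EFin \o f)) x.
  apply/esym; transitivity (heatE (t - s + s) (EFin \o f) x); last by rewrite subrK.
  exact: heatE_semigroup.
have mh : measurable_fun setT (heatE s (EFin \o f)).
  apply: (@measurable_heatE _ _ _ _ (fun=> s) id (fun=> EFin \o f)) => //.
  exact: (@measurableT_comp _ _ _ _ _ _ (EFin \o f) _ snd).
have h0 y : (0 <= heatE s (EFin \o f) y)%E by exact: heatE_ge0.
rewrite -heatEZ//; rewrite /absorption max_r ?(ltW s0)//; apply: le_heatE => //.
- apply/measurable_EFinP; apply: measurableT_comp => //.
  by apply: (measurable_mild_slice sol); exact: ltW.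
- by apply: emeasurable_funM.
- by move=> y; rewrite lee_fin psi_ge0// (mild_ge0 sol)// ltW.
- move=> y; have v0 : 0 <= v s y by rewrite (mild_ge0 sol)// ltW.
  rewrite /stable_mechanism powR1D ?(ltW b_gt0)// EFinM.
  apply: lee_pmul => //.
  + by rewrite lee_fin powR_ge0.
  + by rewrite lee_fin mild_powR_le.
  + exact: (mild_le_heat psi_ge0 sol).
Qed.

Lemma mild_ball_lower_at t x : e ^+ 2 <= t ->
  th0 / 2 * @lower_const R n b * e `^ (n%:R - 2 / b) *
    heat_kernel (b * t / (1 + b)) x <= v t x.
Proof.
move=> et; have t0 : 0 < t by apply: lt_le_trans et; rewrite exprn_gt0.
have hge0 : (0 <= heatE t (EFin \o f) x)%E by apply: heatE_ge0 => y; rewrite lee_fin.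
have hfin : heatE t (EFin \o f) x \is a fin_num.
  apply: heatE_init_fin_num => //.
  by exists theta => y; rewrite /f ball_indE ler_piMr ?(ltW theta_gt0)// lern1 leq_b1.
have I2 : (\int[lebesgue_measure]_(r in `]0%R, t[) absorption (stable_mechanism b) v t x r <=
    2^-1%:E * heatE t (EFin \o f) x)%E.
  apply: (@le_trans _ _ (\int[lebesgue_measure]_(r in `]0%R, t[)
      ((rate r)%:E * heatE t (EFin \o f) x))%E).
    apply: ge0_le_integral => //.
    - by move=> r _; exact: (absorption_ge0 psi_ge0 sol).
    - apply: measurable_funTS.
      exact: (@measurable_absorption _ _ _ _ _ mpsi psi_ge0 sol _ _ (fun=> t) (fun=> x) id).
    - apply: measurable_funTS; apply: emeasurable_funM => //; exact/measurable_EFinP.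
    - move=> r; rewrite /= in_itv/= => rt; exact: absorption_le.
  rewrite ge0_integralZr//; last 2 first.
  - by apply/measurable_EFinP; apply: measurable_funTS.
  - by move=> r _; rewrite lee_fin.
  apply: lee_wpmul2r => //; apply: le_trans integral_rate.
  apply: ge0_subset_integral => //.
  - by apply/measurable_EFinP; apply: measurable_funTS.
  - by move=> r _; rewrite lee_fin.
  - by move=> r /=; rewrite !in_itv/= => /andP[->].
set I := (\int[lebesgue_measure]_(r in `]0%R, t[) _)%E in I2 *.
have eqP : ((v t x)%:E + I = heatE t (EFin \o f) x)%E by exact: (mild_eqD sol x t0).
have le2 : (heatE t (EFin \o f) x <= (v t x)%:E + 2^-1%:E * heatE t (EFin \o f) x)%E.
  by rewrite -{1}eqP leeD2l.
have := heat_ball_lower x b_gt0 e_gt0 et.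
move=> /(lee_wpmul2l (x := theta%:E)); rewrite lee_fin (ltW theta_gt0) => /(_ isT).
rewrite -heat_f; move: le2; rewrite -(fineK hfin) -!EFinM -EFinD !lee_fin.
move: (fine _) => q le2 hq.
have -> : e `^ (n%:R - 2 / b) = e ^+ n * e `^ (- (2 / b)).
  rewrite powRD; last by rewrite (gt_eqF e_gt0) implybT.
  by rewrite powR_mulrn// ltW.
have -> : th0 / 2 * lower_const n b * (e ^+ n * e `^ (- (2 / b))) *
    heat_kernel (b * t / (1 + b)) x =
    (theta * (lower_const n b * e ^+ n * heat_kernel (b * t / (1 + b)) x)) / 2.
  by rewrite /theta; ring.
move: hq le2; move: (theta * _) => z; lra.
Qed.

End ball_lower.

Section ball_lower_existence.
Context (R : realType) (n : nat).

(** With an initial mass of the order of [e `^ (- (2 / b))], a fixed part of the heat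
    flow survives, so the nonlinear solution is comparable to the linear one. *)
Theorem mild_ball_lower (b : R) : 0 < b -> 2 / b < n%:R ->
  exists2 c : R, 0 < c & forall e : R, 0 < e ->
  exists2 theta : R, 0 <= theta & forall v : R -> 'rV[R]_n -> R,
    mild_solution (stable_mechanism b) (fun y => theta * ball_ind e y) v ->
    forall t x, e ^+ 2 <= t ->
    c * e `^ (n%:R - 2 / b) * heat_kernel (b * t / (1 + b)) x <= v t x.
Proof.
move=> b0 bn; have m0 := small_mass_gt0 b0 bn.
exists (small_mass n b / 2 * lower_const n b).
  by rewrite mulr_gt0 ?lower_const_gt0// divr_gt0.
move=> e e0; exists (small_mass n b * e `^ (- (2 / b))).
  by rewrite mulr_ge0 ?powR_ge0// ltW.
by move=> v sol t x; exact: mild_ball_lower_at.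
Qed.

End ball_lower_existence.

(** * The stable and the truncated mechanisms *)

Section mechanisms.
Context (R : realType).
Variable b : R.
Hypotheses (b_gt0 : 0 < b) (b_lt1 : b < 1).

Lemma le_Rintegral_cst (D : set R) (g : R -> R) (x y a : R) : measurable D ->
  measurable_fun setT g -> (forall r, 0 < r -> 0 <= g r) ->
  (forall r, D r -> 0 < r) ->
  (\int[lebesgue_measure]_(r in D) (g r)%:E < +oo)%E ->
  0 < x -> x < y -> (`]x, y[ `<=` D) -> (forall r, x < r < y -> a <= g r) -> 0 <= a ->
  a * (y - x) <= \int[lebesgue_measure]_(r in D) g r.
Proof.
move=> mD mg g0 D0 Dfin x0 xy xyD ag a0.
rewrite /Rintegral -lee_fin fineK; last first.
  rewrite ge0_fin_numE//; apply: integral_ge0 => r Dr.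
  by rewrite lee_fin g0// D0.
apply: (@le_trans _ _ (\int[lebesgue_measure]_(r in `]x, y[) (g r)%:E)%E).
  apply: (@le_trans _ _ (\int[lebesgue_measure]_(r in `]x, y[) a%:E)%E).
    rewrite integral_cst//= lebesgue_measure_itv/= lte_fin xy.
    by rewrite -EFinB -EFinM.
  apply: ge0_le_integral => //.
  by apply/measurable_EFinP; exact: measurable_funTS.
apply: ge0_subset_integral => //.
- by apply/measurable_EFinP; exact: measurable_funTS.
- by move=> r Dr; rewrite lee_fin g0// D0.
Qed.

Let mpowR p : measurable_fun setT (fun x : R => x `^ p).
Proof. exact: measurable_powR. Qed.

(** The integral is finite and positive; a divergent one would make [Gamma], and
    with it [c_beta], vanish. *)
Lemma Gamma_gt0 : 0 < Gamma (1 - b).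
Proof.
rewrite /Gamma; have -> : 1 - b - 1 = - b by ring.
pose g (x : R) := x `^ (- b) * expR (- x).
have mg : measurable_fun setT g.
  by apply: measurable_funM => //; apply: measurableT_comp.
have g0 x : 0 <= g x by rewrite mulr_ge0 ?powR_ge0 ?expR_ge0.
apply: (@lt_le_trans _ _ ((2 `^ (- b) * expR (- 2)) * (2 - 1))).
  by rewrite !mulr_gt0 ?powR_gt0 ?expR_gt0// subr_gt0 ltr1n.
apply: (@le_Rintegral_cst _ g) => //.
- by move=> r /=; rewrite in_itv/= andbT.
- rewrite (_ : `]0%R, +oo[%classic = `]0%R, 1] `|` `]1%R, +oo[); last first.
    by rewrite -itv_bndbnd_setU// bnd_simp.
  rewrite ge0_integral_setU//=; last 3 first.
  + by apply/measurable_EFinP; exact: measurable_funTS.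
  + by move=> r _; rewrite lee_fin.
  + apply/disj_setPLR => s /=; rewrite !in_itv/= andbT => /andP[_ qs].
    by rewrite ltNge qs.
  apply: lte_add_pinfty.
    apply: (@le_lt_trans _ _ (\int[lebesgue_measure]_(x in `]0%R, 1%R]) (x `^ (- b))%:E)%E).
      apply: ge0_le_integral => //.
      * by move=> r _; rewrite lee_fin.
      * by apply/measurable_EFinP; exact: measurable_funTS.
      * by apply/measurable_EFinP; exact: measurable_funTS.
      * move=> r; rewrite /= in_itv/= lee_fin => /andP[r0 _].
        by rewrite /g ler_piMr ?powR_ge0// -expR0 ler_expR oppr_le0 ltW.
    exact: le_lt_trans (integral_powR_head_le ltr01 b_lt1) (ltry _).
  apply: (@le_lt_trans _ _ (\int[lebesgue_measure]_(x in `[1%R, +oo[) (4%:E * (x `^ (- 2))%:E))%E).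
    apply: (@le_trans _ _ (\int[lebesgue_measure]_(x in `]1%R, +oo[) (4%:E * (x `^ (- 2))%:E))%E).
      apply: ge0_le_integral => //.
      * by move=> r _; rewrite lee_fin.
      * by apply/measurable_EFinP; exact: measurable_funTS.
      * apply: emeasurable_funM => //.
        by apply/measurable_EFinP; exact: measurable_funTS.
      * move=> r; rewrite /= in_itv/= andbT -EFinM lee_fin => r1.
        have r0 : 0 < r by exact: lt_trans r1.
        rewrite /g; apply: (@le_trans _ _ (expR (- r))).
          rewrite ler_piMl ?expR_ge0// -[leRHS](powRr0 r) ler_powR ?(ltW r1)//.
          by rewrite oppr_le0 ltW.
        rewrite powRN -[2]/(2%:R) powR_mulrn ?(ltW r0)// expRN.
        (* [expR r >= (r / 2) ^+ 2] *)
        rewrite (_ : 4 / r ^+ 2 = ((r / 2) ^+ 2)^-1); last by field; rewrite gt_eqF.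
        rewrite lef_pV2 ?posrE ?expR_gt0 ?exprn_gt0 ?divr_gt0//.
        rewrite [in leRHS](splitr r) expRD -expr2 lerXn2r ?nnegrE ?expR_ge0 ?divr_ge0 ?ltW//.
        by apply: lt_le_trans (expR_ge1Dx _); rewrite ltrDr.
    apply: ge0_subset_integral => //.
    * apply: emeasurable_funM => //.
      by apply/measurable_EFinP; exact: measurable_funTS.
    * by move=> r _; rewrite mule_ge0// lee_fin powR_ge0.
    * by move=> r /=; rewrite !in_itv/= !andbT => /ltW.
  rewrite ge0_integralZl//; last 2 first.
  + by apply/measurable_EFinP; exact: measurable_funTS.
  + by move=> r _; rewrite lee_fin powR_ge0.
  apply: (@le_lt_trans _ _ (4%:E * (1 `^ (1 - 2) / (2 - 1))%:E)%E).
    by rewrite lee_wpmul2l// integral_powR_tail_le// ltr1n.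
  by rewrite -EFinM ltry.
- by rewrite ltr1n.
- by move=> r /=; rewrite !in_itv/= andbT => /andP[/(lt_trans ltr01)].
- move=> r /andP[r1 r2]; have r0 : 0 < r by exact: lt_trans r1.
  apply: ler_pM; rewrite ?powR_ge0 ?expR_ge0//.
    rewrite !powRN lef_pV2 ?posrE ?powR_gt0//.
    by apply: ge0_ler_powR; rewrite ?nnegrE ltW.
  by rewrite ler_expR lerN2 ltW.
Qed.

Lemma c_beta_gt0 : 0 < c_beta b.
Proof. by rewrite divr_gt0 ?Gamma_gt0// mulr_gt0// addr_gt0. Qed.

Lemma expR_comp_ge0 (y : R) : 0 <= expR (- y) - 1 + y.
Proof. by have h := expR_ge1Dx (- y); lra. Qed.

Lemma expR_comp_le (y : R) : 0 <= y -> expR (- y) - 1 + y <= y ^+ 2.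
Proof.
move=> y0; suff : expR (- y) <= 1 - y + y ^+ 2 by lra.
have y1 : 0 < 1 + y by rewrite ltr_pwDl.
rewrite expRN; apply: (@le_trans _ _ (1 + y)^-1).
  by rewrite lef_pV2 ?posrE ?expR_gt0// expR_ge1Dx.
rewrite -[leLHS]mul1r ler_pdivrMr//.
have -> : (1 - y + y ^+ 2) * (1 + y) = 1 + y ^+ 3 by ring.
by rewrite lerDl exprn_ge0.
Qed.

(** The square of [1 - y / 2 <= expR (- (y / 2))]. *)
Lemma expR_comp_ge (y : R) : 0 <= y <= 2 -> y ^+ 2 / 4 <= expR (- y) - 1 + y.
Proof.
move=> /andP[y0 y2]; have -> : expR (- y) = expR (- (y / 2)) ^+ 2.
  by rewrite expr2 -expRD; congr expR; field.
have h : (1 - y / 2) ^+ 2 <= expR (- (y / 2)) ^+ 2.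
  rewrite lerXn2r ?nnegrE ?expR_ge0//; first by lra.
  exact: expR_ge1Dx.
have e : (1 - y / 2) ^+ 2 = 1 - y + y ^+ 2 / 4 by field.
by move: h; rewrite e; lra.
Qed.

Let powR_le_powRN (x y q : R) : 0 < x -> 0 < y -> 0 <= q -> x * y <= 1 ->
  x `^ q <= y `^ (- q).
Proof.
move=> x0 y0 q0 xy; rewrite powRN -[leRHS]mul1r ler_pdivlMr ?powR_gt0//.
rewrite -powRM ?(ltW x0) ?(ltW y0)//.
have -> : 1 = 1 `^ q :> R by rewrite powR1.
by apply: ge0_ler_powR; rewrite ?nnegrE ?mulr_ge0 ?(ltW x0) ?(ltW y0).
Qed.

Let small_jumps (l r : R) := (expR (- l * r) - 1 + l * r) * r `^ (- 2 - b).

Let small_jumps_ge0 l r : 0 <= small_jumps l r.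
Proof. by rewrite mulr_ge0 ?powR_ge0// mulNr expR_comp_ge0. Qed.

Let measurable_small_jumps : measurable_fun setT (fun p : R * R => small_jumps p.1 p.2).
Proof.
apply: measurable_funM; last exact: (measurableT_comp (mpowR _)).
apply: measurable_funD; last exact: measurable_funM.
apply: measurable_funB => //; apply: measurableT_comp => //.
by apply: measurable_funM => //; apply: measurableT_comp.
Qed.

(** A parameter integral of a nonnegative function is measurable by Tonelli's
    theorem, whether or not it is finite. *)
Lemma measurable_truncated_mechanism K : measurable_fun setT (truncated_mechanism b K).
Proof.
apply: measurable_funD; first by do 2 apply: measurable_funM => //.
apply: measurable_funM => //; rewrite /Rintegral.
apply: (@measurableT_comp _ _ _ _ _ _ (@fine R)) => //.
under eq_fun do rewrite integral_mkcond epatch_indic.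
apply: (measurable_fun_fubini_tonelli_F (m2 := lebesgue_measure)
  (fun p : R * measurableTypeR R =>
     (small_jumps p.1 p.2)%:E * (\1_(`]0%R, K[%classic : set R) p.2 : R)%:E)%E).
  apply: emeasurable_funM; first exact/measurable_EFinP.
  apply/measurable_EFinP.
  exact: (@measurableT_comp _ _ _ _ _ _ (\1_(`]0%R, K[%classic) : R -> R) _ snd).
by move=> p; rewrite mule_ge0// lee_fin.
Qed.

Lemma integral_large_jumps_ge K : 0 < K ->
  (2 `^ (- 1 - b)) * K `^ (- b) <= \int[lebesgue_measure]_(r in `]K, +oo[) r `^ (- 1 - b).
Proof.
move=> K0; have K2 : K < 2 * K by rewrite ltr_pMl// ltr1n.
have -> : 2 `^ (- 1 - b) * K `^ (- b) = (2 * K) `^ (- 1 - b) * (2 * K - K).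
  rewrite powRM ?(ltW K0)// (_ : 2 * K - K = K); last by ring.
  rewrite -mulrA; congr (_ * _); rewrite -{3}(powRr1 (ltW K0)) -powRD ?(gt_eqF K0) ?implybT//.
  by congr (_ `^ _); ring.
apply: le_Rintegral_cst => //.
- by move=> r _; exact: powR_ge0.
- by move=> r /=; rewrite in_itv/= andbT; exact: lt_trans.
- apply: (@le_lt_trans _ _ (\int[lebesgue_measure]_(r in `[K, +oo[) (r `^ (- (1 + b)))%:E)%E).
    rewrite opprD; apply: ge0_subset_integral => //.
    + by apply/measurable_EFinP; exact: measurable_funTS.
    + by move=> r _; rewrite lee_fin powR_ge0.
    + by move=> r /=; rewrite !in_itv/= !andbT => /ltW.
  by apply: le_lt_trans (integral_powR_tail_le K0 _) (ltry _); rewrite ltrDl.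
- by move=> r /=; rewrite !in_itv/= andbT => /andP[].
- move=> r /andP[Kr r2]; have r0 : 0 < r by exact: lt_trans Kr.
  rewrite -opprD !powRN lef_pV2 ?posrE ?powR_gt0 ?mulr_gt0//.
  by apply: ge0_ler_powR; rewrite ?nnegrE ?addr_ge0 ?mulr_ge0 ?ltW.
- exact: powR_ge0.
Qed.

Lemma integral_small_jumps_ge0 K l :
  0 <= \int[lebesgue_measure]_(r in `]0, K[) ((expR (- l * r) - 1 + l * r) * r `^ (- 2 - b)).
Proof. by apply: Rintegral_ge0 => r _; exact: small_jumps_ge0. Qed.

Lemma integral_small_jumps_ge K l : 0 < K -> 1 <= l * K -> 0 < l ->
  l `^ (1 + b) / 32 <=
    \int[lebesgue_measure]_(r in `]0, K[) ((expR (- l * r) - 1 + l * r) * r `^ (- 2 - b)).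
Proof.
move=> K0 lK l0.
have l20 : 0 < l^-1 / 2 by rewrite divr_gt0// invr_gt0.
have ll : l^-1 / 2 < l^-1 by rewrite ltr_pdivrMr// ltr_pMr ?invr_gt0// ltr1n.
have -> : l `^ (1 + b) / 32 = 16^-1 * l `^ (2 + b) * (l^-1 - l^-1 / 2).
  rewrite (_ : l `^ (2 + b) = l * l `^ (1 + b)); first by field; rewrite gt_eqF.
  rewrite -{2}(powRr1 (ltW l0)) -powRD ?(gt_eqF l0) ?implybT//.
  by congr (_ `^ _); ring.
have mj : measurable_fun setT (small_jumps l).
  exact: (@measurableT_comp _ _ _ _ _ _ _ _ (pair l) measurable_small_jumps).
apply: (@le_Rintegral_cst _ (small_jumps l)) => //.
- by move=> r /=; rewrite in_itv/= => /andP[].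
- have cl : 0 <= l ^+ 2 by exact: sqr_ge0.
  apply: (@le_lt_trans _ _ (\int[lebesgue_measure]_(r in `]0%R, K])
      ((l ^+ 2)%:E * (r `^ (- b))%:E))%E).
    apply: (@le_trans _ _ (\int[lebesgue_measure]_(r in `]0%R, K[)
      ((l ^+ 2)%:E * (r `^ (- b))%:E))%E).
      apply: ge0_le_integral => //.
      + by move=> r _; rewrite lee_fin.
      + by apply/measurable_EFinP; exact: measurable_funTS.
      + apply: emeasurable_funM => //.
        by apply/measurable_EFinP; exact: measurable_funTS.
      + move=> r; rewrite /= in_itv/= -EFinM lee_fin => /andP[r0 _].
        rewrite (_ : r `^ (- b) = r ^+ 2 * r `^ (- 2 - b)); last first.
          rewrite -(powR_mulrn 2 (ltW r0)) -powRD ?(gt_eqF r0) ?implybT//.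
          by congr (_ `^ _); ring.
        rewrite /small_jumps mulrA -exprMn ler_wpM2r ?powR_ge0// mulNr.
        by rewrite expR_comp_le// mulr_ge0 ?ltW.
    apply: ge0_subset_integral => //.
    + apply: emeasurable_funM => //.
      by apply/measurable_EFinP; exact: measurable_funTS.
    + by move=> r _; rewrite mule_ge0// lee_fin powR_ge0.
    + by move=> r /=; rewrite !in_itv/= => /andP[-> /ltW].
  rewrite ge0_integralZl//; last 2 first.
  + by apply/measurable_EFinP; exact: measurable_funTS.
  + by move=> r _; rewrite lee_fin powR_ge0.
  apply: (@le_lt_trans _ _ ((l ^+ 2)%:E * (K `^ (1 - b) / (1 - b))%:E)%E).
    by rewrite lee_wpmul2l// integral_powR_head_le.
  by rewrite -EFinM ltry.
- move=> r /=; rewrite !in_itv/= => /andP[lr rl].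
  rewrite (lt_trans l20 lr)/= (lt_le_trans rl)//.
  by rewrite -[_^-1]mulr1 ler_pdivrMl.
- move=> r /andP[lr rl]; have r0 := lt_trans l20 lr.
  have lr1 : l * r <= 1 by rewrite -ler_pdivlMl// mulr1 ltW.
  have lr2 : 2^-1 <= l * r by rewrite -ler_pdivrMl// ltW.
  rewrite /small_jumps; apply: ler_pM; rewrite ?powR_ge0 ?invr_ge0//.
    rewrite mulNr; apply: le_trans (expR_comp_ge _); last first.
      by rewrite (le_trans _ lr2)//= (le_trans lr1)// ler1n.
    have : 2^-1 ^+ 2 <= (l * r) ^+ 2 :> R.
      by rewrite lerXn2r ?nnegrE ?mulr_ge0 ?(ltW l0) ?(ltW r0).
    by lra.
  by rewrite -opprD; apply: powR_le_powRN => //; rewrite addr_ge0// ltW.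
- by rewrite mulr_ge0 ?powR_ge0.
Qed.

(** Truncation only increases the mechanism, as removed mass never returns. Up to
    a constant this is seen directly: for [l * K >= 1] the jumps of size
    about [l^-1] suffice, and for [l * K <= 1] the linear term dominates. *)
Lemma truncated_mechanism_ge K l : 0 < K -> 0 <= l ->
  c_beta b * (2 `^ (- 1 - b) / 32) * l `^ (1 + b) <= truncated_mechanism b K l.
Proof.
move=> K0; have c0 := c_beta_gt0.
rewrite le_eqVlt => /predU1P[<-|l0].
  rewrite powR0 ?mulr0; last by rewrite gt_eqF// addr_gt0.
  rewrite /truncated_mechanism !mul0r add0r mulr_ge0 ?(ltW c0)//.
  exact: integral_small_jumps_ge0.
have p2 : 0 < 2 `^ (- 1 - b) :> R by exact: powR_gt0.
have p21 : 2 `^ (- 1 - b) <= 1 :> R.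
  rewrite -[leRHS](powRr0 (2 : R)) ler_powR ?ler1n//.
  by rewrite -opprD oppr_le0 addr_ge0// ltW.
have lb0 : 0 <= l `^ (1 + b) by exact: powR_ge0.
rewrite /truncated_mechanism; move: (c_beta b) c0 => c c0.
have [lK|Kl] := leP 1 (l * K).
  rewrite -[leLHS]add0r lerD//.
    apply: mulr_ge0; first by apply: mulr_ge0; exact: ltW.
    by apply: le_trans (integral_large_jumps_ge K0); rewrite mulr_ge0 ?powR_ge0.
  rewrite -mulrA ler_pM2l//; apply: le_trans (integral_small_jumps_ge K0 lK l0).
  rewrite mulrAC -[leRHS]mulrC -[X in _ <= X]mulrC ler_pM2r ?invr_gt0//.
  by rewrite ler_piMl.
rewrite -[leLHS]addr0 lerD//; last first.
  by rewrite mulr_ge0 ?(ltW c0)// integral_small_jumps_ge0.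
rewrite [l * _]mulrC -!mulrA ler_pM2l//.
apply: (@le_trans _ _ (l * (2 `^ (- 1 - b) * K `^ (- b)))); last first.
  by rewrite ler_pM2l// integral_large_jumps_ge.
rewrite [leRHS]mulrCA ler_pM2l//.
apply: (@le_trans _ _ (l `^ (1 + b))).
  by rewrite ler_piMl// invf_le1// ler1n.
rewrite powR1D ?(ltW b_gt0) ?(ltW l0)// mulrC ler_pM2l//.
by apply: powR_le_powRN => //; rewrite ltW.
Qed.

End mechanisms.

(** * Clusters that hit a ball *)

Section hitting_probabilities.
Context (R : realType) (n : nat).
Local Notation M := (lfmeasure R n).
Local Open Scope ereal_scope.

Definition hit (e : R) : set M := [set m : M | 0 < m (eball 0%R e)].

Let B (e : R) : set 'rV[R]_n := eball 0%R e.

Lemma measurable_lfm_eval (A : set 'rV[R]_n) :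
  measurable A -> measurable_fun setT (fun m : M => m A).
Proof.
move=> mA _ Y mY; apply: sub_sigma_algebra; exists A => //; by exists Y.
Qed.

Lemma measurable_hit e : measurable (hit e).
Proof.
rewrite -[hit e]setTI; apply: emeasurable_fun_o_infty => //.
by apply: measurable_lfm_eval; exact: measurable_eball.
Qed.

Lemma measurable_expeRN d (T : measurableType d) (h : T -> \bar R) :
  measurable_fun setT h -> (forall x, 0 <= h x) ->
  measurable_fun setT (fun x => expeR (- h x)).
Proof.
move=> mh h0.
rewrite (_ : (fun x => _) = fun x : T =>
    ((\1_[set y | (h y < +oo)%E] x : R) * expR (- fine (h x)))%:E); last first.
  apply/funext => x; rewrite indicE; have := h0 x.
  case hx: (h x) => [r| |]//= _.
    by rewrite mem_set ?mul1r//= hx ltry.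
  by rewrite memNset ?mul0r//= hx ltxx.
apply/measurable_EFinP; apply: measurable_funM.
  apply: measurable_indic; rewrite -[X in measurable X]setTI.
  exact: emeasurable_fun_infty_o.
apply: measurableT_comp => //; apply: measurableT_comp => //.
exact: (@measurableT_comp _ _ _ _ _ _ (@fine R)).
Qed.

(** The integrand of the cluster representation for the test function
    [theta * ball_ind e]; it increases to the indicator of [hit e]. *)
Definition laplace_defect (e theta : R) (m : M) : \bar R := 1 - expeR (- (theta%:E * m (B e))).

Lemma measurable_defect e theta : (0 <= theta)%R -> measurable_fun setT (laplace_defect e theta).
Proof.
move=> t0; apply: emeasurable_funB => //; apply: measurable_expeRN.
  apply: emeasurable_funM => //; apply: measurable_lfm_eval; exact: measurable_eball.
by move=> m; rewrite mule_ge0.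
Qed.

Lemma defect_ge0 e theta m : (0 <= theta)%R -> 0 <= laplace_defect e theta m.
Proof.
move=> t0; have h : expeR (- (theta%:E * m (B e))) <= 1.
  by rewrite -expeR0 lee_expeR leeNl oppe0 mule_ge0.
by rewrite /laplace_defect suber_ge0// ge0_fin_numE ?expeR_ge0// (le_lt_trans h)// ltry.
Qed.

Lemma defect_le_hit e theta m : (0 <= theta)%R ->
  laplace_defect e theta m <= (\1_(hit e) m : R)%:E.
Proof.
move=> t0; rewrite /laplace_defect indicE; case: (boolP (m \in hit e)) => mh /=.
  by rewrite -[leRHS]adde0 leeD2l// leeNl oppe0 expeR_ge0.
have -> : m (B e) = 0.
  apply/eqP; rewrite eq_le measure_ge0 andbT leNgt; apply/negP => h.
  by move/negP: mh; apply; rewrite inE.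
by rewrite mule0 oppe0 expeR0 subee.
Qed.

Lemma nondecreasing_defect e m : nondecreasing_seq (fun k => laplace_defect e k%:R m).
Proof.
move=> j k jk; rewrite /laplace_defect leeD2l// leeN2 lee_expeR leeN2 lee_wpmul2r//.
by rewrite lee_fin ler_nat.
Qed.

Lemma cvg_defect e m : laplace_defect e k%:R m @[k --> \oo] --> (\1_(hit e) m : R)%:E.
Proof.
rewrite indicE; case: (boolP (m \in hit e)) => mh /=; last first.
  have m0 : m (B e) = 0.
    apply/eqP; rewrite eq_le measure_ge0 andbT leNgt; apply/negP => h.
    by move/negP: mh; apply; rewrite inE.
  rewrite /laplace_defect m0; under eq_fun do rewrite mule0 oppe0 expeR0 subee//.
  exact: cvg_cst.
move: mh; rewrite inE /hit/= => mh; rewrite /laplace_defect /B.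
move: (m _) mh => [r| |]// r0; last first.
  apply: cvg_near_cst; exists 1%N => // k /= k1.
  by rewrite gt0_muley ?lte_fin ?ltr0n//= sube0.
rewrite lte_fin in r0.
rewrite (_ : (fun k => _) = (fun k => (1 - (expR (- r)) ^+ k)%:E)); last first.
  by apply/funext => k; rewrite /= -EFinB -expRM_natl mulrN.
apply: cvg_EFin; first exact: nearW.
rewrite -[X in _ --> X](subr0 (1%R : R)).
apply: cvgB; first exact: cvg_cst.
apply: cvg_expr; rewrite ger0_norm ?expR_ge0// expR_lt1.
by rewrite oppr_lt0.
Qed.

Lemma integral_defect_le (P : {measure set M -> \bar R}) e theta : (0 <= theta)%R ->
  \int[P]_m laplace_defect e theta m <= P (hit e).
Proof.
move=> t0; have -> : P (hit e) = \int[P]_m (\1_(hit e) m : R)%:E.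
  by rewrite integral_indic ?setIT//; exact: measurable_hit.
apply: ge0_le_integral => //.
- by move=> m _; exact: defect_ge0.
- exact: measurable_defect.
- by apply/measurable_EFinP; apply: measurable_indic; exact: measurable_hit.
- by move=> m _; exact: defect_le_hit.
Qed.

(** Monotone convergence along integer masses. *)
Lemma hit_le_of_defect (P : {measure set M -> \bar R}) e (g D : R) :
  (forall k : nat, g%:E * \int[P]_m laplace_defect e k%:R m <= D%:E) ->
  g%:E * P (hit e) <= D%:E.
Proof.
move=> h; have -> : P (hit e) = \int[P]_m (\1_(hit e) m : R)%:E.
  by rewrite integral_indic ?setIT//; exact: measurable_hit.
have cv : \int[P]_m laplace_defect e k%:R m @[k --> \oo] --> \int[P]_m (\1_(hit e) m : R)%:E.
  have := @cvg_monotone_convergence _ _ _ P setT measurableT (fun k m => laplace_defect e k%:R m).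
  have lim1 m : limn (fun k => laplace_defect e k%:R m) = (\1_(hit e) m : R)%:E.
    by apply/cvg_lim => //; exact: cvg_defect.
  under [X in _ -> _ -> _ -> _ --> X]eq_integral do rewrite lim1.
  apply.
  - by move=> k; exact: measurable_defect.
  - by move=> k m _; exact: defect_ge0.
  - by move=> m _; exact: nondecreasing_defect.
have cvg := cvgeZl (y := g%:E) isT cv.
rewrite -(cvg_lim _ cvg)//; apply: lime_le; first by apply/cvg_ex; eexists; exact: cvg.
exact: nearW.
Qed.

End hitting_probabilities.

Section cluster_transform.
Context (R : realType) (n : nat) (dO : measure_display) (Omega : measurableType dO).
Local Notation M := (lfmeasure R n).
Variables (law : R.-pker M ~> Omega) (X : R -> Omega -> M).
Variables (psi g : R -> R) (eta : R -> R.-pker 'rV[R]_n ~> M).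
Hypotheses (ll : log_laplace law X psi) (cl : clusters law X g eta).
Local Open Scope ereal_scope.

(** Under the law started at a unit mass at [x], the log-Laplace functional is
    [v t x] on one side and the cluster integral on the other. *)
Lemma cluster_mild e theta : (0 <= theta)%R ->
  exists2 v, mild_solution psi (fun y => theta * ball_ind e y)%R v &
    forall t x, (0 < t)%R ->
      (v t x)%:E = (g t)%:E * \int[eta t x]_m laplace_defect e theta m.
Proof.
move=> th0.
have mf : measurable_fun setT (fun y : 'rV[R]_n => theta * ball_ind e y)%R.
  by apply: measurable_funM => //; exact: measurable_ball_ind.
have f0 (y : 'rV[R]_n) : (0 <= theta * ball_ind e y)%R by rewrite mulr_ge0 ?ball_ind_ge0.
have fB : exists C, forall y : 'rV[R]_n, (theta * ball_ind e y <= C)%R.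
  by exists theta => y; rewrite ball_indE ler_piMr// lern1 leq_b1.
have [v sol vE] := ll mf f0 fB; exists v => // t x t0.
have fin1 : lf_dirac x setT < +oo by rewrite /= diracT ltry.
have := vE _ fin1 t (ltW t0); rewrite [X in _ = expeR (- X)]integral_dirac//; last first.
  by apply/measurable_EFinP; apply: (measurable_mild_slice sol); exact: ltW.
rewrite diracT mul1e; have [_ /(_ _ mf f0) ->] := cl x t0.
move=> /expeR_inj /oppe_inj <-; congr (_ * _); apply: eq_integral => m _.
rewrite /laplace_defect; congr (1 - expeR (- _)).
under eq_integral do rewrite EFinM.
rewrite ge0_integralZl_EFin//; last 2 first.
- by move=> y _; rewrite lee_fin ball_ind_ge0.
- by apply/measurable_EFinP; exact: measurable_ball_ind.
by congr (_ * _); rewrite integral_indic ?setIT//; exact: measurable_eball.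
Qed.

End cluster_transform.

(** * Integration over the initial measure *)

Section cluster_bounds.
Context (R : realType) (n : nat).
Local Notation M := (lfmeasure R n).
Local Open Scope ereal_scope.
Variables (eta : R -> R.-pker 'rV[R]_n ~> M) (t : R).
Variable mu : {sigma_finite_measure set 'rV[R]_n -> \bar R}.
Variables (A : set M) (mA : measurable A).
Variables (phi : 'rV[R]_n -> R) (mphi : measurable_fun setT phi).
Hypothesis phi_ge0 : forall x, (0 <= phi x)%R.

Let meta : measurable_fun setT (fun x => eta t x A).
Proof. exact: measurable_kernel. Qed.

Lemma cluster_measure_le (a C : R) : (0 <= C)%R ->
  (forall x, a%:E * eta t x A <= (C * phi x)%:E) ->
  a%:E * cluster_measure eta t mu A <= C%:E * \int[mu]_x (phi x)%:E.
Proof.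
move=> C0 h; rewrite /cluster_measure.
have i0 : 0 <= \int[mu]_x eta t x A by exact: integral_ge0.
(* For truncated clusters [a] contains a limit whose sign is not known. *)
have [a0|a0] := leP 0%R a; last first.
  apply: (@le_trans _ _ 0); first by rewrite mule_le0_ge0// lee_fin ltW.
  by rewrite mule_ge0// integral_ge0// => x _; rewrite lee_fin.
have mE : measurable_fun setT (EFin \o phi) by exact/measurable_EFinP.
rewrite -ge0_integralZl// -ge0_integralZl//; last by move=> x _; rewrite lee_fin.
apply: ge0_le_integral => //.
- by move=> x _; rewrite mule_ge0.
- exact: emeasurable_funM.
- exact: emeasurable_funM.
Qed.

Lemma cluster_measure_ge (a c : R) : (0 <= a)%R -> (0 <= c)%R ->
  (forall x, (c * phi x)%:E <= a%:E * eta t x A) ->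
  c%:E * \int[mu]_x (phi x)%:E <= a%:E * cluster_measure eta t mu A.
Proof.
move=> a0 c0 h; rewrite /cluster_measure.
have mE : measurable_fun setT (EFin \o phi) by exact/measurable_EFinP.
rewrite -ge0_integralZl//; last by move=> x _; rewrite lee_fin.
rewrite -ge0_integralZl//.
apply: ge0_le_integral => //.
- by move=> x _; rewrite mule_ge0// lee_fin.
- exact: emeasurable_funM.
- exact: emeasurable_funM.
- by move=> x _; rewrite -EFinM; exact: h.
Qed.

End cluster_bounds.

Section hitting_bounds.
Context (R : realType) (n : nat) (b : R).
Hypothesis b_gt0 : 0 < b.
Context (dO : measure_display) (Omega : measurableType dO).
Local Notation M := (lfmeasure R n).
Variables (law : R.-pker M ~> Omega) (X : R -> Omega -> M).
Variables (psi g : R -> R) (eta : R -> R.-pker 'rV[R]_n ~> M).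
Hypotheses (ll : log_laplace law X psi) (cl : clusters law X g eta).
Variables (mu : {sigma_finite_measure set 'rV[R]_n -> \bar R}) (e t : R).
Hypotheses (e_gt0 : 0 < e) (et : e <= Num.sqrt t).
Local Open Scope ereal_scope.

Let t_gt0 : (0 < t)%R.
Proof. by rewrite -sqrtr_gt0 (lt_le_trans e_gt0). Qed.

Let rescale : (e `^ (2 / b - n%:R) * e `^ (n%:R - 2 / b) = 1)%R.
Proof.
rewrite -powRD; last by rewrite (gt_eqF e_gt0) implybT.
by rewrite addrA subrK subrr powRr0.
Qed.

Let mhk s : measurable_fun setT (fun x : 'rV[R]_n => heat_kernel s x).
Proof.
under eq_fun do rewrite -[X in heat_kernel _ X]subr0.
exact: measurable_heat_kernel.
Qed.

Lemma cluster_hit_upper (C : R) : (0 <= C)%R ->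
  (forall (theta : R) (v : R -> 'rV[R]_n -> R), (0 <= theta)%R ->
     mild_solution psi (fun y => theta * ball_ind e y)%R v ->
     forall x : 'rV[R]_n, (v t x <= C * e `^ (n%:R - 2 / b) * heat_kernel (2 * t) x)%R) ->
  (e `^ (2 / b - n%:R) * g t)%:E * cluster_measure eta t mu (hit e) <=
  C%:E * \int[mu]_x (heat_kernel (2 * t) x)%:E.
Proof.
move=> C0 vC; apply: cluster_measure_le => //.
- exact: measurable_hit.
- by move=> x; exact: heat_kernel_ge0.
move=> x; have h : (g t)%:E * eta t x (hit e) <=
    (C * e `^ (n%:R - 2 / b) * heat_kernel (2 * t) x)%:E.
  apply: hit_le_of_defect => k.
  have [v sol vE] := cluster_mild ll cl e (ler0n _ k).
  by rewrite -vE// lee_fin; exact: vC sol x.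
rewrite EFinM -muleA.
have w0 : 0 <= (e `^ (2 / b - n%:R))%:E by rewrite lee_fin powR_ge0.
apply: (le_trans (lee_wpmul2l w0 h)); rewrite -EFinM lee_fin.
rewrite le_eqVlt; apply/orP; left; apply/eqP.
transitivity (C * (e `^ (2 / b - n%:R) * e `^ (n%:R - 2 / b)) *
    heat_kernel (2 * t) x)%R; first by ring.
by rewrite rescale mulr1.
Qed.

Lemma cluster_hit_lower (c s : R) : (0 <= c)%R -> (0 <= g t)%R ->
  (exists2 theta, (0 <= theta)%R & forall v : R -> 'rV[R]_n -> R,
     mild_solution psi (fun y => theta * ball_ind e y)%R v ->
     forall x : 'rV[R]_n, (c * e `^ (n%:R - 2 / b) * heat_kernel s x <= v t x)%R) ->
  c%:E * \int[mu]_x (heat_kernel s x)%:E <=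
  (e `^ (2 / b - n%:R) * g t)%:E * cluster_measure eta t mu (hit e).
Proof.
move=> c0 g0 [theta th0 vc]; apply: cluster_measure_ge => //.
- exact: measurable_hit.
- by move=> x; exact: heat_kernel_ge0.
- by rewrite mulr_ge0// powR_ge0.
move=> x; have [v sol vE] := cluster_mild ll cl e th0.
have h : (c * e `^ (n%:R - 2 / b) * heat_kernel s x)%:E <= (g t)%:E * eta t x (hit e).
  apply: (@le_trans _ _ (v t x)%:E); first by rewrite lee_fin; exact: vc.
  by rewrite vE// lee_wpmul2l ?lee_fin//; exact: integral_defect_le.
rewrite [in leRHS]EFinM -muleA.
have w0 : 0 <= (e `^ (2 / b - n%:R))%:E by rewrite lee_fin powR_ge0.
apply: (le_trans _ (lee_wpmul2l w0 h)); rewrite -EFinM lee_fin.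
rewrite le_eqVlt; apply/orP; left; apply/eqP.
transitivity (c * (e `^ (2 / b - n%:R) * e `^ (n%:R - 2 / b)) * heat_kernel s x)%R.
  by rewrite rescale mulr1.
by ring.
Qed.

End hitting_bounds.

Theorem lemma3p2 (R : realType) (beta : R) (d : nat)
    (beta_gt0 : 0 < beta) (beta_lt1 : beta < 1) (d_gt : 2 / beta < d%:R) :
  exists c C : R, [/\ 0 < c, 0 < C &
  forall (dO : measure_display) (Omega : measurableType dO)
    (law : R.-pker lfmeasure R d ~> Omega) (xi : R -> Omega -> lfmeasure R d),
  superprocess law xi beta ->
  forall eta : R -> R.-pker 'rV[R]_d ~> lfmeasure R d,
  clusters law xi (fun t => (beta * t) `^ (- beta^-1)) eta ->
  forall (mu : {sigma_finite_measure set 'rV[R]_d -> \bar R}) (eps t : R),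
  0 < eps -> eps <= Num.sqrt t ->
  let hit := [set m : lfmeasure R d | (0 < m (eball 0 eps))%E] in
  [/\ (c%:E * \int[mu]_x (heat_kernel (beta * t / (1 + beta)) x)%:E <=
         (eps `^ (2 / beta - d%:R) * (beta * t) `^ (- beta^-1))%:E *
           cluster_measure eta t mu hit)%E,
      ((eps `^ (2 / beta - d%:R) * (beta * t) `^ (- beta^-1))%:E *
           cluster_measure eta t mu hit <=
         C%:E * \int[mu]_x (heat_kernel (2 * t) x)%:E)%E &
      forall (K : R) (dK : measure_display) (OmegaK : measurableType dK)
        (lawK : R.-pker lfmeasure R d ~> OmegaK)
        (xiK : R -> OmegaK -> lfmeasure R d)
        (etaK : R -> R.-pker 'rV[R]_d ~> lfmeasure R d),
      0 < K -> truncated_process lawK xiK beta K ->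
      clusters lawK xiK (fun t => (a_trunc beta K t)^-1) etaK ->
      ((eps `^ (2 / beta - d%:R) * (a_trunc beta K t)^-1)%:E *
           cluster_measure etaK t mu hit <=
         C%:E * \int[mu]_x (heat_kernel (2 * t) x)%:E)%E]].
Proof.
have beta_le1 := ltW beta_lt1.
pose k0 := c_beta beta * (2 `^ (- 1 - beta) / 32).
have k0_gt0 : 0 < k0.
  by rewrite mulr_gt0 ?c_beta_gt0// divr_gt0// powR_gt0.
have [C1 C1_gt0 upper1] := @mild_ball_upper R d _ _ beta_gt0 beta_le1 ltr01.
have [C2 C2_gt0 upper2] := @mild_ball_upper R d _ _ beta_gt0 beta_le1 k0_gt0.
have [c c_gt0 lower] := mild_ball_lower beta_gt0 d_gt.
have C_gt0 : 0 < C1 + C2 by exact: addr_gt0.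
exists c, (C1 + C2); split=> // dO Omega law xi [_ _ ll] eta cl mu eps t eps0 epst hit0.
have t0 : 0 < t by rewrite -sqrtr_gt0 (lt_le_trans eps0).
have epst2 : eps ^+ 2 <= t.
  by rewrite -[leRHS]sqr_sqrtr ?(ltW t0)// lerXn2r ?nnegrE ?sqrtr_ge0// ltW.
have weaken C (x : 'rV[R]_d) : C <= C1 + C2 ->
    C * eps `^ (d%:R - 2 / beta) * heat_kernel (2 * t) x <=
    (C1 + C2) * eps `^ (d%:R - 2 / beta) * heat_kernel (2 * t) x.
  by move=> CC; do 2 rewrite ler_wpM2r ?heat_kernel_ge0 ?powR_ge0//.
split.
- apply: (cluster_hit_lower ll cl) => //; [exact: ltW|exact: powR_ge0|].
  have [theta th0 h] := lower _ eps0; exists theta => // v sol x.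
  exact: h sol t x epst2.
- apply: (cluster_hit_upper ll cl) => //; first exact: ltW.
  move=> theta v th0 sol x; apply: (le_trans _ (weaken C1 x _)); last by rewrite lerDl ltW.
  apply: (upper1 (stable_mechanism beta) _ _ _ _ _ eps0 th0 sol) => //.
  + exact: measurable_powR.
  + by move=> l _; rewrite mul1r.
- move=> K dK OmegaK lawK xiK etaK K0 [_ _ llK] clK.
  apply: (cluster_hit_upper llK clK) => //; first exact: ltW.
  move=> theta v th0 sol x; apply: (le_trans _ (weaken C2 x _)); last by rewrite lerDr ltW.
  apply: (upper2 (truncated_mechanism beta K) _ _ _ _ _ eps0 th0 sol) => //.
  + exact: measurable_truncated_mechanism.
  + by move=> l l0; exact: truncated_mechanism_ge.
Qed.
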